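(* Let $S_1,S_2$ be two skew semistandard tableaux of the same shape $\lambda/\mu$. The following are equivalent: (a) $S_1$ and $S_2$ are shape equivalent; (b) $S_1$ and $S_2$ have the same shape changes by some standard tableau of shape $\mu$; (c) the associated circled arrays of $S_1$ and $S_2$ coincide.
   Context: A skew semistandard tableau of shape $\lambda/\mu$ fills the boxes of $\lambda/\mu$ with positive integers weakly increasing along rows and strictly increasing down columns; boxes of $\mu$ are empty boxes. A (forward) jeu de taquin slide into an inside corner $b$ (a box of the inner shape with no inner-shape box below or to its right): $b$ is a hole; repeatedly move into the hole the smaller of the entries of the filled boxes immediately below and immediately to the right (the one below if equal; the only one if just one exists), the hole moving to the vacated position, until there is no filled box below or to the right; the hole is then removed from the shape. Given a standard tableau $T$ of shape $\mu$ with entries $1,\dots,m$ ($m=|\mu|$), rectifying a skew tableau of shape $\lambda/\mu$ by $T$ means performing jeu de taquin slides into the boxes of $\mu$ in decreasing order of their entries in $T$ ($m$ first, then $m-1$, $\dots$, $1$). Two skew tableaux of shape $\lambda/\mu$ have the same shape changes by $T$ if the sequences of shapes of the skew tableaux produced during these rectifications coincide; they are shape equivalent if they have the same shape changes by every standard tableau of shape $\mu$. Associated circled array: for a skew tableau $S$, let $F_{i,j}$ be the number of boxes in rows $1,\dots,i$ with entry $\le j$, empty boxes counted as entry $0$, and $W_{i,j}=F_{i,j}+F_{i,j+1}-F_{i-1,j}-F_{i+1,j+1}$ ($i\ge1$, $j\ge0$). Let $w_j$ be the one-rowed array with $W_{i,j}$ copies of $i$ for each $i$. The associated circled array of $S$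 is $w_N\leftharpoonup\cdots\leftharpoonup w_0$ for $N$ sufficiently large, empty rows at the bottom disregarded. Here a circled array is a finite list of rows of weakly increasing positive integers (circled; empty rows allowed), a one-rowed array is a finite weakly increasing sequence of positive integers (boxed), and $C\leftharpoonup x$ is defined by: $x^{(1)}=x$; for $p=1,\dots,r$ (rows $C_1,\dots,C_r$ of $C$), list circled entries of $C_p$ and boxed entries of $x^{(p)}$ in the order circled $1$'s, boxed $1$'s, circled $2$'s, boxed $2$'s, $\dots$; treat circled cells as balls and boxed cells as empty; move balls one at a time from left to right, each to the nearest cell on its right that was originally empty and not yet occupied by a moved ball, discarding balls with no such cell; then cells that originally had a ball become boxed with number decreased by one, originally empty cells receiving a ball become circled with the same number, others unchanged, boxed $0$'s deleted; the circled numbers form new row $p$, the boxed numbers form $x^{(p+1)}$; finally $x^{(r+1)}$ is appended as a new last circled row. $x_1\leftharpoonup\cdots\leftharpoonup x_n$ means acting successively with $x_1,\dots,x_n$ on the array with no rows. *)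

(* Defs.v *)
From mathcomp Require Import all_boot.
Set Implicit Arguments. Unset Strict Implicit. Unset Printing Implicit Defensive.

(* A skew tableau of shape la/mu is encoded as a seq of rows           *)
(* (seq (seq nat)); row i has exactly la_i cells, the first mu_i of   *)
(* which are the empty boxes (encoded by 0), the others carry positive *)
(* entries.  Rows/columns are 0-indexed internally.                    *)

Definition is_partition (la : seq nat) : bool :=
  all (fun x => 0 < x) la && sorted geq la.

Definition part (la : seq nat) (i : nat) : nat := nth 0 la i.

Definition subpart (mu la : seq nat) : bool :=
  (size mu <= size la) && all (fun i => part mu i <= part la i) (iota 0 (size la)).

Definition tget (t : seq (seq nat)) (i j : nat) : nat := nth 0 (nth [::] t i) j.
Definition inbox (t : seq (seq nat)) (i j : nat) : bool := j < size (nth [::] t i).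
Definition filled (t : seq (seq nat)) (i j : nat) : bool := inbox t i j && (0 < tget t i j).

Definition is_skew_sst (la mu : seq nat) (t : seq (seq nat)) : Prop :=
  [/\ is_partition la, is_partition mu, subpart mu la &
      size t = size la] /\ [/\
      (forall i, i < size la -> size (nth [::] t i) = part la i),
      (forall i j, i < size la -> j < part la i ->
          (tget t i j == 0) = (j < part mu i)),
      (forall i j, filled t i j -> filled t i j.+1 -> tget t i j <= tget t i j.+1)
    & (forall i j, filled t i j -> filled t i.+1 j -> tget t i j < tget t i.+1 j)].

Definition is_standard (mu : seq nat) (T : seq (seq nat)) : Prop :=
  [/\ is_partition mu &
      size T = size mu] /\ [/\
      (forall i, i < size mu -> size (nth [::] T i) = part mu i),
      perm_eq (flatten T) (iota 1 (sumn mu)),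
      (forall i j, inbox T i j -> inbox T i j.+1 -> tget T i j < tget T i j.+1)
    & (forall i j, inbox T i j -> inbox T i.+1 j -> tget T i j < tget T i.+1 j)].

Definition tset (t : seq (seq nat)) (i j v : nat) : seq (seq nat) :=
  set_nth [::] t i (set_nth 0 (nth [::] t i) j v).

(* the hole is at (i,j) *)
Fixpoint slide_from (fuel : nat) (t : seq (seq nat)) (i j : nat) : seq (seq nat) :=
  match fuel with
  | 0 => t
  | f.+1 =>
    let fb := filled t i.+1 j in
    let fr := filled t i j.+1 in
    let down := slide_from f (tset (tset t i j (tget t i.+1 j)) i.+1 j 0) i.+1 j in
    let right := slide_from f (tset (tset t i j (tget t i j.+1)) i j.+1 0) i j.+1 in
    if fb && fr then (if tget t i.+1 j <= tget t i j.+1 then down else right)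
    else if fb then down
    else if fr then right
    else (* remove the hole from the shape *)
      set_nth [::] t i (take j (nth [::] t i))
  end.

(* forward slide into the inside corner (i,j); the fuel bounds the
   number of moves of the hole (each move increases i+j). *)
Definition slide (t : seq (seq nat)) (i j : nat) : seq (seq nat) :=
  slide_from (size t + sumn (map size t)).+1 (tset t i j 0) i j.

Definition skew_shape (t : seq (seq nat)) : seq nat * seq nat :=
  ([seq size r | r <- t & 0 < size r],
   [seq count (pred1 0) r | r <- t & 0 < count (pred1 0) r]).

Definition pos (T : seq (seq nat)) (k : nat) : nat * nat :=
  let i := find (fun r => k \in r) T in (i, index k (nth [::] T i)).

Fixpoint rect_shapes (T : seq (seq nat)) (k : nat) (t : seq (seq nat))
  : seq (seq nat * seq nat) :=
  match k with
  | 0 => [::]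
  | k'.+1 => let t' := slide t (pos T k).1 (pos T k).2 in
             skew_shape t' :: rect_shapes T k' t'
  end.

Definition shape_changes (T S : seq (seq nat)) : seq (seq nat * seq nat) :=
  skew_shape S :: rect_shapes T (size (flatten T)) S.

Definition same_shape_changes (T S1 S2 : seq (seq nat)) : Prop :=
  shape_changes T S1 = shape_changes T S2.

Definition shape_equivalent (mu : seq nat) (S1 S2 : seq (seq nat)) : Prop :=
  forall T, is_standard mu T -> same_shape_changes T S1 S2.

(* A circled array is a seq of rows (seq nat); a one-rowed array is a  *)
(* seq nat.                                                           *)

(* cells: (number, circled?) ; order: circled 1's, boxed 1's, circled 2's, ... *)
Definition cell_key (c : nat * bool) : nat := c.1.*2 + ~~ c.2.

(* processing of one row: returns (new circled row p, boxed array x^(p+1)) *)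
Definition row_step (c x : seq nat) : seq nat * seq nat :=
  let cells := sort (fun a b => cell_key a <= cell_key b)
                    ([seq (v, true) | v <- c] ++ [seq (v, false) | v <- x]) in
  let n := size cells in
  let cell k := nth (0, false) cells k in
  let balls := [seq k <- iota 0 n | (cell k).2] in
  let step (occ : seq bool) (b : nat) :=
      match [seq k <- iota b.+1 (n - b.+1) | ~~ (cell k).2 && ~~ nth false occ k] with
      | k :: _ => set_nth false occ k true
      | [::] => occ (* ball discarded *)
      end in
  let occ := foldl step (nseq n false) balls in
  ([seq (cell k).1 | k <- iota 0 n & ~~ (cell k).2 && nth false occ k],
   [seq v <- [seq (if (cell k).2 then (cell k).1 - 1 else (cell k).1)
             | k <- iota 0 n & (cell k).2 || ~~ nth false occ k] | v != 0]).

Fixpoint act (C : seq (seq nat)) (x : seq nat) : seq (seq nat) :=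
  match C with
  | [::] => [:: x]
  | c :: C' => (row_step c x).1 :: act C' (row_step c x).2
  end.

(* F_{i,j}: boxes in rows 1..i with entry <= j (empty boxes = 0) *)
Definition Fcount (t : seq (seq nat)) (i j : nat) : nat :=
  sumn [seq count (fun v => v <= j) r | r <- take i t].

Definition Wcount (t : seq (seq nat)) (i j : nat) : nat :=
  (Fcount t i j + Fcount t i j.+1) - (Fcount t i.-1 j + Fcount t i.+1 j.+1).

(* w_j : W_{i,j} copies of i for each i (W_{i,j} = 0 for i > #rows) *)
Definition wrow (t : seq (seq nat)) (j : nat) : seq nat :=
  flatten [seq nseq (Wcount t i j) i | i <- iota 1 (size t)].

Fixpoint drop_nil (C : seq (seq nat)) : seq (seq nat) :=
  match C with
  | [::] :: C' => drop_nil C'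
  | _ => C
  end.
Definition strip (C : seq (seq nat)) : seq (seq nat) := rev (drop_nil (rev C)).

Definition circ_N (t : seq (seq nat)) (N : nat) : seq (seq nat) :=
  strip (foldl act [::] [seq wrow t (N - k) | k <- iota 0 N.+1]).

Definition same_circled_array (S1 S2 : seq (seq nat)) : Prop :=
  exists N0, forall N, N0 <= N -> circ_N S1 N = circ_N S2 N.

(* Main.v *)
Require Import Defs.
From mathcomp Require Import all_boot zify.

(* Let lambda^j be the shape formed by the entries at most j of a skew tableau, so
   that W_{i,j} = lambda^j_i - lambda^{j+1}_{i+1}.  In a slide lambda^j loses a box in
   one row r_j, where r_0 is the row of the inside corner.  If r_j occurs in w_j then
   r_{j+1} = r_j and one r_j of w_j becomes r_j - 1; otherwise r_{j+1} = r_j + 1 and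
   w_j is unchanged.  Thus a slide is a particle crossing w_0, w_1, ..

   Let a particle r cross a circled row c as follows: if r occurs in c, one r of c
   becomes r - 1 and the particle goes on as r - 1; otherwise nothing changes.  The two
   crossing rules and the processing of one row by a one-rowed array satisfy a
   Yang-Baxter relation, so the circled array after the slide is obtained from the one
   before it by sending r_0 through its rows.  The particle reaches 0 in some row, and
   the index of this row is that from which the outer shape loses its box: this is seen
   on the array of the large entries, whose rows are w, w - 1, w - 2, .. for a constant
   w.  Crossing is invertible once this index is known.

   Hence, under a slide into a fixed corner, two tableaux of the same shape have equal
   circled arrays if and only if the resulting shapes and circled arrays are equal.  When
   the inner shape is empty, the circled array is empty, as the rows after w_j has
   acted contain only numbers at most j.  By induction, for each single standard
   tableau T, having the same shape changes by T means having equal circled arrays. *)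

Set Implicit Arguments.
Unset Strict Implicit.
Unset Printing Implicit Defensive.

(** * Counting in sequences of numbers *)

Lemma nth_leq_count s v i : sorted leq s -> i < size s ->
  (nth 0 s i <= v) = (i < count (fun y => y <= v) s).
Proof.
elim: s i => [|x s IHs] i //= pxs.
have ge_x y : y \in s -> x <= y.
  by move/(order_path_min leq_trans)/allP: pxs; apply.
case: (leqP x v) => [le_xv|lt_vx].
  case: i => [|i] lt_is; first by rewrite /= le_xv add1n.
  by rewrite /= IHs ?(path_sorted pxs) // add1n.
have -> : count (fun y => y <= v) s = 0.
  apply/eqP; rewrite -leqn0 leqNgt -has_count; apply/hasPn => y /ge_x.
  by rewrite -ltnNge; apply: leq_trans.
case: i => [|i] /= lt_is.
  by rewrite leqNgt lt_vx ltn0.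
by rewrite leqNgt (leq_trans lt_vx) ?ge_x ?mem_nth.
Qed.

Lemma mem_count (s : seq nat) v : (v \in s) = (0 < count_mem v s).
Proof. by rewrite -has_count has_pred1. Qed.

Lemma eq_sorted_count s1 s2 : sorted leq s1 -> sorted leq s2 ->
  (forall v, count_mem v s1 = count_mem v s2) -> s1 = s2.
Proof.
move=> srt1 srt2 eq12; apply: (sorted_eq leq_trans anti_leq) => //.
by apply/allP => v _; apply/eqP/eq12.
Qed.

Lemma count_nth_iota (T : Type) (x0 : T) (P : pred T) s :
  count P s = count (fun k => P (nth x0 s k)) (iota 0 (size s)).
Proof. by rewrite -{1}(mkseq_nth x0 s) /mkseq count_map. Qed.

Lemma sub_in_count (T : eqType) (P Q : pred T) s :
  {in s, forall y, P y -> Q y} -> count P s <= count Q s.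
Proof.
move=> PQ; rewrite (@eq_in_count _ P (predI P Q)).
  by apply: sub_count => y /andP[].
by move=> y /PQ /=; case: (P y) => // ->.
Qed.

Lemma count_add1 (P Q : pred nat) k s : uniq s -> k \in s -> ~~ P k ->
  count (fun j => Q j && ((j == k) || P j)) s
  = Q k + count (fun j => Q j && P j) s.
Proof.
move=> + + nPk; elim: s => //= j s IHs /andP[j_s us]; rewrite inE.
have [eq_kj|neq_jk] := eqVneq k j; last first.
  by move=> /= /(IHs us)->; rewrite addnCA.
subst j => _; rewrite (negPf nPk) andbT andbF add0n; congr (_ + _).
by apply: eq_in_count => i /= i_s; case: eqP => // eq_ik; rewrite -eq_ik i_s in j_s.
Qed.

(** * The action of a one-rowed array on a circled row *)

Lemma head_filter_iota (P : pred nat) a m :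
  match [seq k <- iota a m | P k] with
  | k :: _ => [/\ a <= k, k < a + m, P k & forall j, a <= j -> j < k -> ~~ P j]
  | [::] => forall j, a <= j -> j < a + m -> ~~ P j
  end.
Proof.
elim: m a => [|m IHm] a /=; first by move=> j; lia.
case: ifPn => [Pa|nPa]; first by split=> // [|j]; lia.
case: [seq k <- _ | _] (IHm a.+1) => [|k s].
  move=> H j; rewrite leq_eqVlt => /predU1P[<- //|lt_aj] ?; apply: H => //; lia.
case=> lt_ak lt_k Pk min_k; split=> //; try lia.
by move=> j; rewrite leq_eqVlt => /predU1P[<- //|]; apply: min_k.
Qed.

Section BallMoves.

Variable cells : seq (nat * bool).
Notation cell k := (nth (0, false) cells k).
Notation n := (size cells).

Definition move_ball (occ : seq bool) (b : nat) :=
  match [seq k <- iota b.+1 (n - b.+1) | ~~ (cell k).2 && ~~ nth false occ k] with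
  | k :: _ => set_nth false occ k true
  | [::] => occ
  end.

Definition landing := foldl move_ball (nseq n false) [seq k <- iota 0 n | (cell k).2].

Notation occ_below occ q := (count (fun k => (k < q) && nth false occ k) (iota 0 n)).

(* Together these two conditions force the occupied cells: every ball lands to
   its right, and nothing is left empty in front of an unplaced ball. *)
Definition greedy (bs : seq nat) (occ : seq bool) :=
  [/\ forall k, nth false occ k -> (k < n) && ~~ (cell k).2,
      forall q, occ_below occ q <= count (fun b => b < q) bs
    & forall q, q < n -> ~~ (cell q).2 -> ~~ nth false occ q ->
        occ_below occ q = count (fun b => b < q) bs].

(** The ball lands on the first free cell [k0] to its right, so for a cell [q] that stays free,
    [b < q] and [k0 < q] are equivalent and both counts grow together. If the ball is discarded, no
    free cell lies beyond [b]. *)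
Lemma greedy_move bs occ b : greedy bs occ -> greedy (b :: bs) (move_ball occ b).
Proof.
case=> occP occ_le occ_eq; rewrite /move_ball.
have := head_filter_iota (fun k => ~~ (cell k).2 && ~~ nth false occ k) b.+1 (n - b.+1).
case: [seq k <- _ | _] => [none|k0 s [lt_bk lt_kn /andP[bk0 nk0] min_k0]].
  split=> // q; first by rewrite /= (leq_trans (occ_le q)) ?leq_addl.
  move=> lt_qn bq nq; rewrite occ_eq //=.
  case: ltnP => // lt_bq; have lt_q : q < b.+1 + (n - b.+1) by lia.
  by have := none q lt_bq lt_q; rewrite bq nq.
have nthE j : nth false (set_nth false occ k0 true) j = (j == k0) || nth false occ j.
  by rewrite nth_set_nth /=; case: eqP.
have cntE q : occ_below (set_nth false occ k0 true) q = (k0 < q) + occ_below occ q.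
  under eq_count => j do rewrite nthE.
  by apply: (count_add1 (fun j => j < q)); rewrite ?iota_uniq ?mem_iota //; lia.
split=> [k|q|q lt_qn bq].
- by rewrite nthE => /predU1P[->|/occP//]; rewrite bk0 andbT; lia.
- by rewrite cntE /= leq_add //; lia.
- rewrite nthE negb_or cntE /= => /andP[neq_qk nq]; rewrite occ_eq //.
  congr (_ + _); have := min_k0 q; rewrite bq nq /=.
  by case: (ltnP b q); case: (ltngtP k0 q) => //; try lia.
Qed.

Lemma greedy_landing : greedy [seq k <- iota 0 n | (cell k).2] landing.
Proof.
have gen bs' bs occ : greedy bs' occ -> greedy (catrev bs bs') (foldl move_ball occ bs).
  by elim: bs bs' occ => //= b bs IHbs bs' occ /(greedy_move b)/IHbs.
have : greedy [::] (nseq n false).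
  split=> [k|q|q _ _ _]; rewrite ?nth_nseq ?if_same //=;
   under eq_count => j do rewrite nth_nseq if_same andbF; by rewrite count_pred0.
move=> /(gen _ [seq k <- iota 0 n | (cell k).2]); rewrite -/landing.
case=> occP occ_le occ_eq; split=> // q.
  by have := occ_le q; rewrite catrevE cats0 count_rev.
by move=> *; rewrite occ_eq // catrevE cats0 count_rev.
Qed.

End BallMoves.

Definition row_cells (c x : seq nat) :=
  sort (fun a b => cell_key a <= cell_key b)
       ([seq (v, true) | v <- c] ++ [seq (v, false) | v <- x]).

Lemma row_stepE c x :
  let cells := row_cells c x in
  let cell k := nth (0, false) cells k in
  let occ := landing cells in
  row_step c x =
  ([seq (cell k).1 | k <- iota 0 (size cells) & ~~ (cell k).2 && nth false occ k],
   [seq v <- [seq (if (cell k).2 then (cell k).1 - 1 else (cell k).1)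
             | k <- iota 0 (size cells) & (cell k).2 || ~~ nth false occ k] | v != 0]).
Proof. by []. Qed.

Lemma count_row_cells (P : pred (nat * bool)) c x :
  count P (row_cells c x)
  = count (fun v => P (v, true)) c + count (fun v => P (v, false)) x.
Proof. by rewrite count_sort count_cat !count_map. Qed.

Lemma row_cells_sorted c x : sorted leq (map cell_key (row_cells c x)).
Proof.
by rewrite sorted_map; apply: sort_sorted => a b; apply: leq_total.
Qed.

Lemma row_cells_le c x i j : i <= j -> j < size (row_cells c x) ->
  cell_key (nth (0, false) (row_cells c x) i)
  <= cell_key (nth (0, false) (row_cells c x) j).
Proof.
move=> le_ij lt_j; have lt_i := leq_ltn_trans le_ij lt_j.
have := sorted_leq_nth leq_trans leqnn 0 (row_cells_sorted c x).
move=> /(_ i j); rewrite !inE size_map => /(_ lt_i lt_j le_ij).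
by rewrite !(nth_map (0, false)).
Qed.

Lemma row_step_sorted1 c x : sorted leq (row_step c x).1.
Proof.
rewrite row_stepE /= sorted_map.
apply: (@sub_in_sorted _ (fun k => k < size (row_cells c x)) ltn) => [i j||].
- move=> _ lt_j lt_ij /=; have := row_cells_le (ltnW lt_ij) lt_j.
  rewrite /cell_key; case: (nth _ _ i) => u []; case: (nth _ _ j) => w [] /=; lia.
- by apply/allP => k; rewrite mem_filter mem_iota => /andP[_ /andP[]].
- by apply: sorted_filter (iota_ltn_sorted _ _); apply: ltn_trans.
Qed.

(** Circled cells precede boxed cells of the same number, so a boxed [u] followed by a circled [w]
    has [u < w], and decreasing [w] by one keeps the order. *)
Lemma row_step_sorted2 c x : sorted leq (row_step c x).2.
Proof.
rewrite row_stepE /=; apply: sorted_filter; first exact: leq_trans.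
rewrite sorted_map.
apply: (@sub_in_sorted _ (fun k => k < size (row_cells c x)) ltn) => [i j||].
- move=> _ lt_j lt_ij /=; have := row_cells_le (ltnW lt_ij) lt_j.
  rewrite /cell_key; case: (nth _ _ i) => u []; case: (nth _ _ j) => w [] /=; lia.
- by apply/allP => k; rewrite mem_filter mem_iota => /andP[_ /andP[]].
- by apply: sorted_filter (iota_ltn_sorted _ _); apply: ltn_trans.
Qed.

(* [carrier c x v] balls are still unplaced when the cells numbered [v] are reached. *)
Fixpoint carrier (c x : seq nat) (v : nat) : nat :=
  if v is u.+1 then carrier c x u + count_mem u c - count_mem u x else 0.

Section RowStepCounts.

Variables c x : seq nat.
Notation cells := (row_cells c x).
Notation cell k := (nth (0, false) cells k).
Notation n := (size cells).
Notation occ k := (nth false (landing cells) k).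
Notation landed v := (count (fun k => occ k && ((cell k).1 == v)) (iota 0 n)).
Notation landed_le v := (count (fun k => occ k && ((cell k).1 <= v)) (iota 0 n)).

Lemma landed_le_count v : landed_le v <= count (fun u => u <= v) c.
Proof.
have [occP occ_le _] := greedy_landing cells.
(* The keys of cells numbered [v] are [v.*2] (circled) and [v.*2.+1] (boxed), so [q] is the position
   just after the last cell numbered at most [v]. *)
set q := count (fun u => u <= v.*2.+1) (map cell_key cells).
have qP k : k < n -> (k < q) = ((cell k).1 <= v).
  move=> lt_k; rewrite -nth_leq_count ?size_map ?row_cells_sorted //.
  by rewrite (nth_map (0, false)) // /cell_key; case: (nth _ _ k) => u [] /=; lia.
have := occ_le q; rewrite (_ : count _ _ = landed_le v); last first.
  apply: eq_in_count => k; rewrite mem_iota add0n => /andP[_ lt_k] /=.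
  by rewrite qP // andbC.
move=> /leq_trans; apply; rewrite count_filter.
rewrite (@eq_in_count _ _ (fun k => (cell k).2 && ((cell k).1 <= v))).
  rewrite -(count_nth_iota (0, false) (fun a => a.2 && (a.1 <= v))).
  by rewrite count_row_cells /= count_pred0 addn0.
by move=> k; rewrite mem_iota add0n => /andP[_ lt_k] /=; rewrite qP // andbC.
Qed.

Lemma landed_max v : landed v <= count_mem v x.
Proof.
have [occP _ _] := greedy_landing cells.
have -> : count_mem v x = count (fun a => ~~ a.2 && (a.1 == v)) cells.
  by rewrite count_row_cells /= count_pred0.
rewrite (count_nth_iota (0, false)); apply: sub_count => k /andP[/occP/andP[_ ->]].
by [].
Qed.

(** Some boxed cell [q] numbered [v] stays free, so every ball to its left has landed before [q].
    These balls include all circled numbers up to [v], as circled [v] precede boxed [v]. *)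
Lemma landed_le_full v : landed v < count_mem v x ->
  landed_le v = count (fun u => u <= v) c.
Proof.
have [occP _ occ_eq] := greedy_landing cells.
move=> lt_v; apply/eqP; rewrite eqn_leq landed_le_count /=.
have /hasP[q] : has (fun q => [&& ~~ (cell q).2, (cell q).1 == v & ~~ occ q]) (iota 0 n).
  apply: contraLR lt_v; rewrite -leqNgt -all_predC => /allP none.
  have -> : count_mem v x = count (fun a => ~~ a.2 && (a.1 == v)) cells.
    by rewrite count_row_cells /= count_pred0.
  rewrite (count_nth_iota (0, false)); apply: sub_in_count => k /none /=.
  by case: (nth _ _ k) => u []; case: eqP; case: (nth false _ k).
rewrite mem_iota add0n => /andP[_ lt_q] /and3P[bq /eqP eq_qv nq].
have := occ_eq q lt_q bq nq; rewrite count_filter => eq_q.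
apply: (@leq_trans (count (fun k => (cell k).2 && ((cell k).1 <= v)) (iota 0 n))).
  rewrite -(count_nth_iota (0, false) (fun a => a.2 && (a.1 <= v))).
  by rewrite count_row_cells /= count_pred0 addn0.
apply: (@leq_trans (count (fun k => (k < q) && occ k) (iota 0 n))).
  rewrite eq_q; apply: sub_in_count => k; rewrite mem_iota => /andP[_ lt_k] /=.
  case/andP=> ck le_k; rewrite ck andbT ltnNge; apply/negP => le_qk.
  have := row_cells_le le_qk lt_k; rewrite /cell_key ck (negPf bq) eq_qv /=; lia.
apply: sub_in_count => k; rewrite mem_iota => /andP[_ lt_k] /= /andP[lt_kq ok].
rewrite ok /=; have := row_cells_le (ltnW lt_kq) lt_q; rewrite /cell_key (negPf bq) eq_qv.
by case: (nth _ _ k) => u [] /=; lia.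
Qed.

Lemma landedE v : landed v = minn (carrier c x v + count_mem v c) (count_mem v x).
Proof.
have leS s (P : nat -> bool) (f : nat -> nat) v' :
    count (fun k => P k && (f k <= v'.+1)) s
    = count (fun k => P k && (f k <= v')) s + count (fun k => P k && (f k == v'.+1)) s.
  by elim: s => //= k s ->; case: (P k) => //=; lia.
have le0 s (P : nat -> bool) (f : nat -> nat) :
    count (fun k => P k && (f k <= 0)) s = count (fun k => P k && (f k == 0)) s.
  by apply: eq_count => k /=; rewrite leqn0.
have cle0 : count (fun u => u <= 0) c = count_mem 0 c.
  by apply: eq_count => u; rewrite leqn0.
have cleS v' : count (fun u => u <= v'.+1) c = count (fun u => u <= v') c + count_mem v'.+1 c.
  exact: (leS c predT id v').
(* The preceding bounds determine [landed] inductively: either all boxed [v'] are filled, or no ball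
   numbered at most [v'] is left to carry. *)
have carE v' : carrier c x v'.+1 = count (fun u => u <= v') c - landed_le v' /\
   landed v' = minn (carrier c x v' + count_mem v' c) (count_mem v' x).
  elim: v' => [|v' [IH1 IH2]].
    have := landed_le_count 0; have := @landed_le_full 0; have := landed_max 0.
    have -> : carrier c x 1 = count_mem 0 c - count_mem 0 x by [].
    have -> : carrier c x 0 = 0 by [].
    by rewrite cle0 le0; split; lia.
  have := landed_le_count v'.+1; have := @landed_le_full v'.+1; have := landed_max v'.+1.
  have := landed_le_count v'; rewrite cleS leS.
  have -> : carrier c x v'.+2 = carrier c x v'.+1 + count_mem v'.+1 c - count_mem v'.+1 x by [].
  by rewrite IH1; split; lia.
by case: (carE v).
Qed.

Lemma count_row_step1 v :
  count_mem v (row_step c x).1 = minn (carrier c x v + count_mem v c) (count_mem v x).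
Proof.
have [occP _ _] := greedy_landing cells.
rewrite -landedE row_stepE /= count_map count_filter; apply: eq_in_count => k _ /=.
by case: (boolP (occ k)) => [/occP/andP[_ ->]|]; rewrite ?andbF ?andbT.
Qed.

Lemma count_row_step2 v :
  count_mem v (row_step c x).2 =
  if v == 0 then 0
  else count_mem v x - (carrier c x v + count_mem v c) + count_mem v.+1 c.
Proof.
have [occP _ _] := greedy_landing cells.
rewrite row_stepE /= count_filter count_map count_filter.
have [->|v_neq0] := eqVneq v 0.
  by rewrite -[RHS](count_pred0 (iota 0 n)); apply: eq_count => k /=; case: (_ == 0).
have -> : count_mem v x - (carrier c x v + count_mem v c) = count_mem v x - landed v.
  by rewrite landedE; lia.
have -> : count_mem v x = count (fun a => ~~ a.2 && (a.1 == v)) cells.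
  by rewrite count_row_cells /= count_pred0.
have -> : count_mem v.+1 c = count (fun a => a.2 && (a.1 == v.+1)) cells.
  by rewrite count_row_cells /= count_pred0 addn0.
rewrite !(count_nth_iota (0, false)).
elim: (iota 0 n) => //= k s; set P := count _ s; set Q := count _ s.
set L := count _ s; set M := count _ s.
(* Landing cells are boxed, which makes the truncated subtraction exact. *)
have le_LQ : L <= Q by apply: sub_count => i /= /andP[/occP/andP[_ ->]].
have := occP k; case: (nth (0, false) _ k) => u [] /=; case: (nth false _ k) => /=; try lia.
Qed.

End RowStepCounts.

(** * A particle crossing circled and boxed rows *)

(* Otherwise [/=] unfolds [(row_step c x).1]. *)
#[local] Opaque row_step.

Definition is_row (s : seq nat) := sorted leq s && (0 \notin s).

Lemma is_row_count0 s : is_row s -> count_mem 0 s = 0.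
Proof. by case/andP=> _ /count_memPn. Qed.

Lemma count_row_step2S c x v : count_mem v.+1 (row_step c x).2 =
  count_mem v.+1 x - (carrier c x v.+1 + count_mem v.+1 c) + count_mem v.+2 c.
Proof. by rewrite count_row_step2. Qed.

Lemma row_step_row1 c x : is_row x -> is_row (row_step c x).1.
Proof.
move/is_row_count0=> x0; rewrite /is_row row_step_sorted1.
by apply/count_memPn; rewrite count_row_step1 x0 minn0.
Qed.

Lemma row_step_row2 c x : is_row (row_step c x).2.
Proof.
by rewrite /is_row row_step_sorted2; apply/count_memPn; rewrite count_row_step2.
Qed.

Lemma eq_row s1 s2 : is_row s1 -> is_row s2 ->
  (forall v, count_mem v.+1 s1 = count_mem v.+1 s2) -> s1 = s2.
Proof.
move=> row1 row2 eq12; have [/andP[srt1 _] /andP[srt2 _]] := (row1, row2).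
by apply: eq_sorted_count => // -[|v]; rewrite ?is_row_count0.
Qed.

Definition lower (r : nat) (s : seq nat) :=
  sort leq [seq v <- r.-1 :: rem r s | v != 0].

Lemma lower_row r s : is_row (lower r s).
Proof.
rewrite /is_row sort_sorted; last exact: leq_total.
by rewrite mem_sort mem_filter eqxx.
Qed.

Lemma count_lower r s v : count_mem v.+1 (lower r s)
  = (v.+2 == r) + (count_mem v.+1 s - (v.+1 == r)).
Proof.
rewrite count_sort count_filter (@eq_count _ _ (pred1 v.+1)); last first.
  by move=> u /=; case: eqP => // ->.
rewrite /= count_mem_rem (eq_sym r); congr (_ + _).
by case: r => [|r] //=; rewrite eq_sym.
Qed.

(* The hole of a slide sits in row [r] and meets the strip of entries [j+1], recorded
   in the uncircled array [x]: it moves right if [r] occurs in [x] and down otherwise.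
   The value [r = 0] stands for the absence of a hole. *)
Definition cross_strip (r : nat) (x : seq nat) : seq nat * nat :=
  if r == 0 then (x, 0) else if r \in x then (lower r x, r) else (x, r.+1).

Definition cross_row (r : nat) (c : seq nat) : seq nat * nat :=
  if r \in c then (lower r c, r.-1) else (c, r).

Lemma cross_strip_row r x : is_row x -> is_row (cross_strip r x).1.
Proof. by rewrite /cross_strip => rx; do 2 case: ifP => // _; rewrite lower_row. Qed.

Lemma cross_row_row r c : is_row c -> is_row (cross_row r c).1.
Proof. by rewrite /cross_row => rc; case: ifP => // _; rewrite lower_row. Qed.

Lemma cross_strip_eq0 r x : ((cross_strip r x).2 == 0) = (r == 0).
Proof. by rewrite /cross_strip; case: (eqVneq r 0) => // /negPf r_neq0; case: ifP. Qed.

Lemma cross_row0 c : is_row c -> cross_row 0 c = (c, 0).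
Proof. by case/andP=> _ /negPf c0; rewrite /cross_row c0. Qed.

(** Rows are compared by multiplicities, which [carrier] governs. Lowering [x] or [c] changes the
    carrier at one number only and by at most one ([eqK] in each case), so each case is a local
    computation at [v] near [r]. *)
Lemma yang_baxter r c x : is_row c -> is_row x ->
  let r1 := (cross_strip r x).2 in
  let c' := (row_step c x).1 in
  let x' := (row_step c x).2 in
  let r' := (cross_row r c').2 in
  row_step (cross_row r1 c).1 (cross_strip r x).1
    = ((cross_row r c').1, (cross_strip r' x').1)
  /\ (cross_strip r' x').2 = (cross_row r1 c).2.
Proof.
move=> rc rx r1 c' x' r'; have rc' : is_row c' := row_step_row1 c rx.
have rx' : is_row x' := row_step_row2 c x.
case: r => [|q] in r1 r' *; first by rewrite /r' /r1 !cross_row0 //= -surjective_pairing.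
have c'E v : count_mem v c' = minn (carrier c x v + count_mem v c) (count_mem v x).
  exact: count_row_step1.
have x'E v : count_mem v.+1 x' =
    count_mem v.+1 x - (carrier c x v.+1 + count_mem v.+1 c) + count_mem v.+2 c.
  exact: count_row_step2S.
suff main : [/\ forall v, count_mem v.+1 (row_step (cross_row r1 c).1 (cross_strip q.+1 x).1).1
                  = count_mem v.+1 (cross_row q.+1 c').1,
                forall v, count_mem v.+1 (row_step (cross_row r1 c).1 (cross_strip q.+1 x).1).2
                  = count_mem v.+1 (cross_strip r' x').1
              & (cross_strip r' x').2 = (cross_row r1 c).2].
  case: main => eq1 eq2 ->; split=> //; rewrite [LHS]surjective_pairing; congr (_, _).
    by apply: eq_row => //; [apply/row_step_row1/cross_strip_row|apply: cross_row_row].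
  by apply: eq_row => //; [apply: row_step_row2|apply: cross_strip_row].
have carS c0 x0 v : carrier c0 x0 v.+1 = carrier c0 x0 v + count_mem v c0 - count_mem v x0 by [].
have c00 := is_row_count0 rc; have x00 := is_row_count0 rx.
have low0 p s : count_mem 0 (lower p s) = 0 by rewrite is_row_count0 ?lower_row.
rewrite /r' /r1 {r' r1} /cross_strip /=; have [q_x|q_x] := boolP (q.+1 \in x); rewrite /cross_row /=.
  have [q_c|q_c] := boolP (q.+1 \in c).
    have eqK v : carrier (lower q.+1 c) (lower q.+1 x) v = carrier c x v.
      elim: v => // v; rewrite !carS => ->; case: v => [|v]; first by rewrite !low0 c00 x00.
      move: q_c q_x; rewrite !mem_count !count_lower; have [<-|] := eqVneq v q; lia.
    have -> : q.+1 \in c' by move: q_c q_x; rewrite !mem_count c'E; lia.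
    have q_x' : q == 0 \/ q \in x'.
      case: q q_c {q_x eqK} => [|p]; [by left | right; rewrite mem_count x'E; move: q_c; rewrite mem_count; lia].
    have -> : (if q == 0 then (x', 0) else if q \in x' then (lower q x', q) else (x', q.+1))
             = (if q == 0 then x' else lower q x', q).
      by case: q_x' => [/eqP->|->] //; case: eqP => // ->.
    rewrite !mem_count in q_x q_c; split=> // v.
      rewrite count_row_step1 eqK !count_lower c'E.
      by have [eq_vq|] := eqVneq v q; [subst v|]; lia.
    rewrite count_row_step2S eqK !count_lower [RHS](fun_if (count_mem v.+1)) count_lower !x'E.
    have [eq_vq|ne_vq] := eqVneq v q; first by subst v; case: (eqVneq q 0) => [q0|_]; [subst q|]; lia.
    have [eq_vq|ne_vq'] := eqVneq v.+1 q; first by subst q; case: (eqVneq v.+1 0) => // _; lia.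
    by case: (eqVneq q 0); lia.
  rewrite !mem_count in q_x q_c *.
  have eqK v : carrier c (lower q.+1 x) v = carrier c x v - (v == q.+1).
    elim: v => // v; rewrite !carS => ->; case: v => [|v]; first by rewrite low0 c00 x00 /=; lia.
    rewrite !count_lower; have [eq_vq|ne_vq] := eqVneq v.+1 q; first by subst q; lia.
    by have [eq_vq|ne_vq'] := eqVneq v q; [subst v|]; lia.
  have := c'E q.+1; rewrite carS => c'q.
  have [q_c'|q_c'] := boolP (0 < count_mem q.+1 c').
    have q_gt0 : 0 < q by case: q c'q {eqK q_x} q_c q_c' => // -> ; rewrite /= c00; lia.
    (* As [q.+1] is not in [c], a ball landing on [q.+1] was carried past the boxed [q]; hence all
       of those were filled and no [q] is left in [x']. *)
    have x'q : (0 < count_mem q x') = false.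
      by case: q q_gt0 c'q q_c {q_x eqK} q_c' => // q _; rewrite x'E; lia.
    rewrite x'q gtn_eqF //=; split=> // v.
      rewrite count_row_step1 eqK !count_lower c'E.
      have [eq_vq|ne_vq] := eqVneq v q; first by subst v; rewrite carS; lia.
      by have [eq_vq|ne_vq'] := eqVneq v.+1 q; [subst q|]; lia.
    rewrite count_row_step2S eqK !count_lower x'E.
    have [eq_vq|ne_vq] := eqVneq v q; first by subst v; rewrite carS; lia.
    by have [eq_vq|ne_vq'] := eqVneq v.+1 q; [subst q|]; lia.
  have -> : 0 < count_mem q.+1 x' by rewrite x'E carS; lia.
  split=> //= v.
    rewrite count_row_step1 eqK !count_lower c'E.
    have [eq_vq|ne_vq] := eqVneq v q; first by subst v; rewrite carS; lia.
    by have [eq_vq|ne_vq'] := eqVneq v.+1 q; [subst q|]; lia.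
  rewrite count_row_step2S eqK !count_lower x'E.
  have [eq_vq|ne_vq] := eqVneq v q; first by subst v; rewrite carS; lia.
  by have [eq_vq|ne_vq'] := eqVneq v.+1 q; [subst q|]; lia.
have -> : q.+1 \in c' = false by move: q_x; rewrite !mem_count c'E; lia.
rewrite !mem_count in q_x *; rewrite x'E.
(* Since [x] has no [q.+1], any [q.+1] in [x'] is a decreased circled [q.+2] of [c]: the particle is
   met in both orders or in neither. *)
have [q_c|q_c] := boolP (0 < count_mem q.+2 c); last first.
  have -> : (0 < count_mem q.+1 x - (carrier c x q.+1 + count_mem q.+1 c) + count_mem q.+2 c) = false by lia.
  by [].
have -> : 0 < count_mem q.+1 x - (carrier c x q.+1 + count_mem q.+1 c) + count_mem q.+2 c by lia.
have eqK v : carrier (lower q.+2 c) x v = carrier c x v + (v == q.+2).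
  elim: v => // v; rewrite !carS => ->; case: v => [|v]; first by rewrite low0 c00 x00 /=; lia.
  rewrite !count_lower; have [eq_vq|ne_vq] := eqVneq v q; first by subst v; lia.
  by have [eq_vq|ne_vq'] := eqVneq v q.+1; [subst v|]; lia.
split=> //= v.
  rewrite count_row_step1 eqK !count_lower c'E.
  have [eq_vq|ne_vq] := eqVneq v q; first by subst v; lia.
  by have [eq_vq|ne_vq'] := eqVneq v q.+1; [subst v|]; lia.
rewrite count_row_step2S eqK !count_lower x'E.
have [eq_vq|ne_vq] := eqVneq v q; first by subst v; lia.
have [eq_vq|ne_vq'] := eqVneq v q.+1; first by subst v; lia.
by have [eq_vq|ne_vq''] := eqVneq v.+1 q; [subst q|]; lia.
Qed.

(** * Crossing a circled array *)

Fixpoint cross (r : nat) (C : seq (seq nat)) : seq (seq nat) :=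
  if C is c :: C' then (cross_row r c).1 :: cross (cross_row r c).2 C' else [::].

(* The row in which the particle drops to 0; the junk value [size C] if there is none. *)
Fixpoint exit_row (r : nat) (C : seq (seq nat)) : nat :=
  if C is c :: C' then
    if (cross_row r c).2 == 0 then 0 else (exit_row (cross_row r c).2 C').+1
  else 0.

Lemma size_act C x : size (act C x) = (size C).+1.
Proof. by elim: C x => //= c C IHC x; rewrite IHC. Qed.

Lemma act_rows C x : all is_row C -> is_row x -> all is_row (act C x).
Proof.
elim: C x => [|c C IHC] x /=; first by move=> _ ->.
by case/andP=> _ rC rx; rewrite row_step_row1 ?IHC ?row_step_row2.
Qed.

Lemma cross0 C : all is_row C -> cross 0 C = C.
Proof.
by elim: C => //= c C IHC /andP[rc rC]; rewrite cross_row0 //= IHC.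
Qed.

(** [yang_baxter] is applied row by row; on the final row, which is the boxed row itself, the two
    crossing rules have the same effect. *)
Lemma cross_act r C x : all is_row C -> is_row x ->
  cross r (act C x) = act (cross (cross_strip r x).2 C) (cross_strip r x).1.
Proof.
elim: C r x => [|c C IHC] r x /=.
  move=> _ rx; rewrite /cross_strip; have [->|_] := eqVneq r 0.
    by rewrite cross_row0.
  by rewrite /cross_row; case: ifP.
case/andP=> rc rC rx; rewrite IHC ?row_step_row2 //.
by have [-> /= ->] := yang_baxter r rc rx.
Qed.

(** Crossing a strip never creates or destroys the particle, so it vanishes in the same row before
    and after the action. The bound excludes the junk value and the newly appended row. *)
Lemma exit_row_act r C x : all is_row C -> is_row x -> 0 < r ->
  exit_row (cross_strip r x).2 C < size C ->
  exit_row r (act C x) = exit_row (cross_strip r x).2 C.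
Proof.
elim: C r x => // c C IHC r x /= /andP[rc rC] rx r_gt0.
have [_ /=] := yang_baxter r rc rx.
set r' := (cross_row r _).2; set x' := (row_step c x).2 => eq_r.
rewrite -eq_r cross_strip_eq0; case: (posnP r') => [_ //|r'_gt0].
by rewrite ltnS => lt_C; rewrite IHC ?row_step_row2.
Qed.

(** If only the first particle is met, then [s = r.-1], which occurs in the lowered row; but this
    row is [c2], where [s] does not occur. *)
Lemma cross_row_inj r s c1 c2 : is_row c1 -> is_row c2 -> 0 < r -> 0 < s ->
  cross_row r c1 = cross_row s c2 -> c1 = c2 /\ r = s.
Proof.
have mixed r' c : 1 < r' -> r'.-1 \in lower r' c.
  by case: r' => [|[|p]] // _; rewrite mem_count count_lower eqxx.
move=> rc1 rc2; case: r => // r _; case: s => // s _; rewrite /cross_row.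
case: ifP => r_c1; case: ifP => s_c2 [] // eq_c; last by move->.
- move=> /= eq_rs; subst s; split=> //; apply: eq_row => // v.
  have /(congr1 (count_mem v.+1)) := eq_c; rewrite !count_lower.
  by move: r_c1 s_c2; rewrite !mem_count; have [<-|] := eqVneq v r; lia.
- by move=> /= eq_rs; subst r c2; rewrite -[s.+1]/(s.+2.-1) mixed in s_c2.
- by move=> /= eq_rs; subst s c1; rewrite -[r.+1]/(r.+2.-1) mixed in r_c1.
Qed.

(** Below the common exit row nothing changes and both particles are 0; from there the crossing is
    undone upwards by [cross_row_inj]. *)
Lemma cross_inj r s C1 C2 : all is_row C1 -> all is_row C2 -> 0 < r -> 0 < s ->
  exit_row r C1 < size C1 -> exit_row r C1 = exit_row s C2 ->
  cross r C1 = cross s C2 -> C1 = C2 /\ r = s.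
Proof.
elim: C1 r s C2 => [|c1 C1 IHC] r s [|c2 C2] //=.
case/andP=> rc1 rC1 /andP[rc2 rC2] r_gt0 s_gt0 lt_size eq_exit [eq_c eq_C].
suff [eqC eq_r] : C1 = C2 /\ (cross_row r c1).2 = (cross_row s c2).2.
  have [-> ->] // : c1 = c2 /\ r = s; last by rewrite eqC.
  by apply: cross_row_inj => //; rewrite [LHS]surjective_pairing eq_c eq_r -surjective_pairing.
move: lt_size eq_exit eq_C.
case: (posnP (cross_row r c1).2) => [->|r'_gt0];
  case: (posnP (cross_row s c2).2) => [->|s'_gt0] //=.
  by move=> _ _; rewrite !cross0.
by rewrite ltnS => lt_C [] eq_exit; apply: IHC.
Qed.

(** * Repeated action of one and the same row *)

Definition pred_row (u : seq nat) := [seq v <- map predn u | v != 0].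

Fixpoint stack (n : nat) (u : seq nat) : seq (seq nat) :=
  if n is n'.+1 then u :: stack n' (pred_row u) else [::].

Lemma pred_row_row u : is_row u -> is_row (pred_row u).
Proof.
case/andP=> srt _; rewrite /is_row mem_filter eqxx andbT.
apply: (sorted_filter leq_trans); apply: homo_sorted srt => a b; lia.
Qed.

Lemma count_pred_row u v : count_mem v.+1 (pred_row u) = count_mem v.+2 u.
Proof.
rewrite count_filter count_map; apply: eq_count => -[|w] //=.
by rewrite eqSS; case: eqP => [->|].
Qed.

(** The circled [v] fill exactly the boxed [v], so no ball is ever carried on to a larger number. *)
Lemma row_step_diag u : is_row u -> row_step u u = (u, pred_row u).
Proof.
move=> ru; have car0 v : carrier u u v = 0 by elim: v => //= v ->; rewrite subnn.
rewrite [LHS]surjective_pairing; congr (_, _); apply: eq_row => //.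
- exact: row_step_row1.
- by move=> v; rewrite count_row_step1 car0 minnn.
- exact: row_step_row2.
- exact: pred_row_row.
- by move=> v; rewrite count_row_step2S car0 subnn count_pred_row.
Qed.

Lemma act_stack n u : is_row u -> act (stack n u) u = stack n.+1 u.
Proof.
elim: n u => //= n IHn u ru.
by rewrite row_step_diag //= IHn ?pred_row_row.
Qed.

(** If [r] occurs in [u], then [r.-1], unless 0, occurs in [pred_row u]: the particle is met in
    every row and drops by one each time. *)
Lemma exit_row_stack r n u : is_row u -> 0 < r -> r \in u -> r <= n ->
  exit_row r (stack n u) = r.-1.
Proof.
elim: n r u => [|n IHn] [|[|r]] u //= ru _ r_u le_n; rewrite /cross_row r_u //=.
by rewrite IHn ?pred_row_row // mem_count count_pred_row -mem_count.
Qed.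

(** * Circled arrays without stripping of empty rows *)

Lemma drop_nilE C : nseq (size C - size (drop_nil C)) [::] ++ drop_nil C = C.
Proof.
elim: C => //= -[|a c] C IHC; last by rewrite subnn.
have le_size : size (drop_nil C) <= size C by rewrite -{2}IHC size_cat leq_addl.
by rewrite subSn //= IHC.
Qed.

Lemma strip_inj C1 C2 : size C1 = size C2 -> strip C1 = strip C2 -> C1 = C2.
Proof.
rewrite /strip => eq_size /(can_inj revK) eq_drop; apply: (can_inj revK).
by rewrite -(drop_nilE (rev C1)) -(drop_nilE (rev C2)) eq_drop !size_rev eq_size.
Qed.

(* The result of letting [w_{j+n-1}, .., w_j] act in this order. *)
Fixpoint circled (t : seq (seq nat)) (j n : nat) : seq (seq nat) :=
  if n is n'.+1 then act (circled t j.+1 n') (wrow t j) else [::].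

Lemma size_circled t j n : size (circled t j n) = n.
Proof. by elim: n j => //= n IHn j; rewrite size_act IHn. Qed.

Lemma circ_NE t N : circ_N t N = strip (circled t 0 N.+1).
Proof.
have gen m : m <= N.+1 -> foldl act [::] [seq wrow t (N - k) | k <- iota 0 m]
                          = circled t (N.+1 - m) m.
  elim: m => // m IHm lt_m; rewrite -addn1 iotaD map_cat foldl_cat IHm 1?ltnW //=.
  by rewrite addn1 subSS subSn.
by rewrite /circ_N gen // subnn.
Qed.

Lemma same_circled_arrayE t1 t2 : same_circled_array t1 t2 <->
  exists N0, forall N, N0 <= N -> circled t1 0 N = circled t2 0 N.
Proof.
split=> -[N0 eqN].
  exists N0.+1 => -[|N] // lt_N; apply: strip_inj; first by rewrite !size_circled.
  by rewrite -!circ_NE eqN.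
by exists N0 => N le_N; rewrite !circ_NE eqN ?leqW.
Qed.

(** * Slides and circled arrays *)

Definition cnt (t : seq (seq nat)) (i v : nat) : nat :=
  count (fun y => y <= v) (nth [::] t i).

(* Rows are 0-indexed, and [cnt t i v] is the [i]th part of the shape formed by the
   entries at most [v]; the second condition says that consecutive such shapes differ
   by a horizontal strip. *)
Definition semistandard (t : seq (seq nat)) : Prop :=
  (forall i, sorted leq (nth [::] t i)) /\
  (forall i v, cnt t i.+1 v.+1 <= cnt t i v).

Lemma cnt_default t i v : size t <= i -> cnt t i v = 0.
Proof. by move=> le_i; rewrite /cnt nth_default. Qed.

Lemma leq_cnt t i v w : v <= w -> cnt t i v <= cnt t i w.
Proof. by move=> le_vw; apply: sub_count => y /leq_trans; apply. Qed.

Lemma cnt_bounded t : exists M, forall i v, M <= v -> cnt t i v = size (nth [::] t i).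
Proof.
exists (\max_(y <- flatten t) y) => i v le_v; apply/eqP; rewrite -all_count.
apply/allP => y y_t; apply: leq_trans le_v; apply: leq_bigmax_seq => //.
have [lt_i|le_i] := ltnP i (size t); last by rewrite nth_default in y_t.
by apply/flattenP; exists (nth [::] t i); rewrite ?mem_nth.
Qed.

Lemma FcountS t i j : Fcount t i.+1 j = Fcount t i j + cnt t i j.
Proof.
rewrite /Fcount; have [lt_i|le_i] := ltnP i (size t).
  by rewrite (take_nth [::]) // map_rcons -cats1 sumn_cat /= addn0.
by rewrite cnt_default // addn0 !take_oversize // ltnW.
Qed.

Lemma WcountS t i j : Wcount t i.+1 j = cnt t i j - cnt t i.+1 j.+1.
Proof. by rewrite /Wcount /= !FcountS; lia. Qed.

Lemma count_flatten_nseq f a m v :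
  count_mem v (flatten [seq nseq (f i) i | i <- iota a m])
  = if a <= v < a + m then f v else 0.
Proof.
elim: m a => [|m IHm] a /=; first by case: ifP => //; lia.
rewrite count_cat IHm count_nseq /=; have [->|ne_av] := eqVneq a v.
  by rewrite mul1n ltnn /= leqnn addn0 -ltn_psubLR ?subnn // ifT; lia.
by rewrite mul0n add0n; congr (if _ then _ else _); lia.
Qed.

Lemma sorted_flatten_nseq f a m :
  sorted leq (flatten [seq nseq (f i) i | i <- iota a m]).
Proof.
rewrite sorted_pairwise; last exact: leq_trans.
elim: m a => //= m IHm a; rewrite pairwise_cat IHm andbT; apply/andP; split.
  apply/allrelP => y z /nseqP[-> _] /flattenP[_ /mapP[i + ->] /nseqP[-> _]].
  by rewrite mem_iota => /andP[/ltnW].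
by rewrite -sorted_pairwise; [elim: (f a) => //= -[|k] //= ->; rewrite leqnn | apply: leq_trans].
Qed.

Lemma wrow_row t j : is_row (wrow t j).
Proof.
rewrite /is_row sorted_flatten_nseq; apply/count_memPn.
by rewrite count_flatten_nseq.
Qed.

Lemma count_wrow t j v : count_mem v.+1 (wrow t j) = cnt t v j - cnt t v.+1 j.+1.
Proof.
rewrite count_flatten_nseq WcountS; case: ifP => // lt_v.
by rewrite cnt_default //; lia.
Qed.

Lemma circled_rows t j n : all is_row (circled t j n).
Proof. by elim: n j => //= n IHn j; rewrite act_rows ?wrow_row. Qed.

(* [d v] is the row in which the shape of the entries at most [v] loses its box. *)
Definition slid (t t' : seq (seq nat)) (d : nat -> nat) : Prop :=
  [/\ size t' = size t,
      forall k v, cnt t' k v + (k == d v) = cnt t k v,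
      forall v, d v.+1 = if cnt t (d v).+1 v.+1 < cnt t (d v) v then d v else (d v).+1
    & exists V, forall v, V <= v -> d v = d V].

(** The strip inequality could fail only in row [d v], where the upper side loses a box. If it is
    tight there, the rule for [d] makes the row below lose a box as well. *)
Lemma slid_semistandard t t' d : semistandard t -> slid t t' d ->
  (forall i, sorted leq (nth [::] t' i)) -> semistandard t'.
Proof.
move=> [_ strip_t] [_ cntE dS _] srt; split=> // i v.
have := cntE i v; have := cntE i.+1 v.+1; have := strip_t i v; have := dS v.
have [->|ne_i] := eqVneq i (d v); last by lia.
by case: ifP => lt_d ->; lia.
Qed.

Section Slid.

Variables (t t' : seq (seq nat)) (d : nat -> nat).
Hypotheses (t_sst : semistandard t) (tt' : slid t t' d).

(** The test in the rule for [d] says exactly that the particle occurs in [wrow t j]. The shift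
    [(d j).+1] arises because tableau rows are numbered from 0 and particles from 1. *)
Lemma cross_strip_wrow j :
  cross_strip (d j).+1 (wrow t j) = (wrow t' j, (d j.+1).+1).
Proof.
have [_ cntE dS _] := tt'; have [_ strip_t] := t_sst.
rewrite /cross_strip /= mem_count count_wrow subn_gt0 dS; case: ifP => lt_d; congr (_, _).
  apply: eq_row; rewrite ?lower_row ?wrow_row // => v; rewrite count_lower !count_wrow.
  have := cntE v j; have := cntE v.+1 j.+1; have := strip_t v j; have := dS j.
  rewrite lt_d => ->; rewrite eqSS.
  have [->|ne_v] := eqVneq v (d j); first by lia.
  by have [eq_v|ne_v'] := eqVneq v.+1 (d j); lia.
apply: eq_row; rewrite ?wrow_row // => v; rewrite !count_wrow.
have := cntE v j; have := cntE v.+1 j.+1; have := strip_t v j; have := dS j.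
rewrite lt_d => ->; rewrite eqSS.
by have [eq_v|ne_v] := eqVneq v (d j); [subst v|]; lia.
Qed.

Lemma circled_slid j n : circled t' j n = cross (d j).+1 (circled t j n).
Proof.
elim: n j => //= n IHn j.
by rewrite cross_act ?circled_rows ?wrow_row // cross_strip_wrow /= IHn.
Qed.

Lemma circled_stable M w : (forall j, M <= j -> wrow t j = w) ->
  forall j n, M <= j -> circled t j n = stack n w.
Proof.
move=> wE j n; have rw : is_row w by rewrite -(wE M) ?wrow_row.
elim: n j => //= n IHn j le_j.
by rewrite IHn ?wE // 1?ltnW // act_stack.
Qed.

(* Far out, the array looks like [w, w-1, w-2, ..], and the particle leaves it in
   the row from which the outer shape loses its box. *)
Lemma slid_exit : exists D N0,
  (forall k, size (nth [::] t' k) + (k == D) = size (nth [::] t k)) /\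
  (forall N, N0 <= N -> exit_row (d 0).+1 (circled t 0 N) = D /\ D < N).
Proof.
have [_ cntE dS [V dV]] := tt'; have [M1 cM1] := cnt_bounded t.
have [M2 cM2] := cnt_bounded t'.
set M := maxn V (maxn M1 M2); set D := d V; set w := wrow t M.
have dM j : M <= j -> d j = D by move=> le_j; apply: dV; lia.
exists D, (M + D.+1); split.
  by move=> k; have := cntE k M; rewrite cM1 ?cM2 ?dM //; lia.
have wE j : M <= j -> wrow t j = w.
  move=> le_j; apply: eq_row; rewrite ?wrow_row // => v.
  by rewrite !count_wrow !cM1 //; lia.
(* From [M] on [d] is constant, so its rule takes the first branch. *)
have D_w : D.+1 \in w.
  rewrite -has_pred1 has_count count_wrow subn_gt0; have := dS M.
  by rewrite !dM //; case: ifP => // _; lia.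
(* The exit row is known at level [M] and is carried down to level 0, one acting row at a time. *)
have gen k n : k <= M -> D < n ->
    exit_row (d (M - k)).+1 (circled t (M - k) (k + n)) = D.
  move=> + lt_D; elim: k => [|k IHk] lt_k.
    by rewrite subn0 dM // (circled_stable wE) // exit_row_stack ?wrow_row.
  have Mk : (M - k.+1).+1 = M - k by lia.
  have eqk : exit_row (cross_strip (d (M - k.+1)).+1 (wrow t (M - k.+1))).2
      (circled t (M - k.+1).+1 (k + n)) = D by rewrite cross_strip_wrow Mk IHk // ltnW.
  by rewrite addSn /= exit_row_act ?circled_rows ?wrow_row // eqk size_circled; lia.
move=> N le_N; split; last by lia.
by have := gen M (N - M); rewrite subnn subnKC; [apply|]; lia.
Qed.

End Slid.

Lemma circled_straight t n : semistandard t -> (forall i, cnt t i 0 = 0) ->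
  circled t 0 n = nseq n [::].
Proof.
move=> [_ strip_t] t0.
have cnt0 i v : v <= i -> cnt t i v = 0.
  elim: v i => [|v IHv] [|i] // le_vi; apply/eqP.
  by rewrite -leqn0 (leq_trans (strip_t _ _)) ?IHv.
have count0 s v : (v \notin s) = (count_mem v s == 0).
  by rewrite -has_pred1 has_count lt0n negbK.
(* A boxed [v] passed on to the next row comes from a boxed [v] or a circled [v.+1], so the bound
   [j.+1] on the old array becomes [j] after [wrow t j] has acted. At [j = 0] only empty rows
   remain. *)
have small j m c v : c \in circled t j m -> j < v -> v \notin c.
  have small_wrow j' v' : j' < v' -> v' \notin wrow t j'.
    by case: v' => // v' lt_v; rewrite count0 count_wrow cnt0.
  elim: m j c v => //= m IHm j c v.
  have: forall c0 v0, c0 \in circled t j.+1 m -> j.+1 < v0 -> v0 \notin c0.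
    by move=> c0 v0; apply: IHm.
  move: (small_wrow j) v; move: (wrow t j) (circled t j.+1 m) => x C.
  elim: C x => [|c0 C IHC] x /= x_small v C_small.
    by rewrite inE => /eqP->; apply: x_small.
  rewrite inE => /predU1P[-> lt_v|c_C].
    by rewrite count0 count_row_step1; move: (x_small v lt_v); rewrite count0 => /eqP->; rewrite minn0.
  apply: (IHC _ _ _ _ c_C) => [v' lt_v|c1 v1 c1C]; last first.
    by apply: C_small; rewrite inE c1C orbT.
  case: v' lt_v => // v' lt_v; rewrite count0 count_row_step2S.
  move: (x_small _ lt_v); rewrite count0 => /eqP->; rewrite sub0n add0n.
  by rewrite -count0 C_small // inE eqxx.
apply/(@eq_from_nth _ [::]); rewrite ?size_nseq size_circled // => i lt_i.
rewrite nth_nseq lt_i; have c_C : nth [::] (circled t 0 n) i \in circled t 0 n.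
  by rewrite mem_nth ?size_circled.
have /andP[_ c0] := allP (circled_rows t 0 n) _ c_C.
case: (nth _ _ _) c_C c0 => // -[|v] c c_C //= _.
by have := small _ _ _ v.+1 c_C isT; rewrite inE eqxx.
Qed.

(** * Jeu de taquin slides *)

Lemma sorted_cat_cons A e B : sorted leq (A ++ e :: B) =
  [&& sorted leq A, sorted leq B, all (fun y => y <= e) A & all (leq e) B].
Proof.
rewrite !(sorted_pairwise leq_trans) pairwise_cat allrel_consr /=.
apply/idP/idP; first by case/and4P=> /andP[-> _] -> -> ->.
case/and4P=> -> -> le_A le_B; rewrite le_A le_B !andbT.
by apply/allrelP => y z /(allP le_A) le_ye /(allP le_B); apply: leq_trans.
Qed.

Lemma set_nth_cat_cons A (x y : nat) B : set_nth 0 (A ++ x :: B) (size A) y = A ++ y :: B.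
Proof. by elim: A => //= a A ->. Qed.

Lemma split_at (s : seq nat) j : j < size s ->
  exists A B, s = A ++ nth 0 s j :: B /\ size A = j.
Proof.
move=> lt_j; exists (take j s), (drop j.+1 s).
by rewrite -drop_nth // cat_take_drop size_takel // ltnW.
Qed.

Lemma nth_tset t i j v k :
  nth [::] (tset t i j v) k = if k == i then set_nth 0 (nth [::] t i) j v else nth [::] t k.
Proof. by rewrite nth_set_nth. Qed.

Lemma size_tset t i j v : i < size t -> size (tset t i j v) = size t.
Proof. by move=> lt_i; rewrite size_set_nth; apply/maxn_idPr. Qed.

(* A tableau in the course of a slide: the hole, encoded by 0, is in row [i] and
   column [j], and [m] is the entry that moved last (0 before the first move). *)
Record punctured (t : seq (seq nat)) (i j m : nat) (A B : seq nat) : Prop := Punctured {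
  punct_row : nth [::] t i = A ++ 0 :: B;
  punct_col : size A = j;
  punct_sorted : sorted leq (A ++ m :: B);
  punct_gt0 : all (leq 1) B;
  punct_others : forall k, k != i -> sorted leq (nth [::] t k);
  punct_strip : forall k, i < k -> forall v, cnt t k.+1 v.+1 <= cnt t k v;
  punct_below : cnt t i.+1 m <= j
}.

(** The analogue of [slid] for the rest of a slide. The rule for [d] is asked only from [m] on;
    below [m] it is recovered when the moves are undone one by one. *)
Definition slide_result t i m t' d : Prop :=
  [/\ size t' = size t /\ (forall k, sorted leq (nth [::] t' k)),
      forall k v, cnt t' k v + (k == d v) = cnt t k v,
      forall v, v <= m -> d v = i,
      forall v, m <= v ->
        d v.+1 = if cnt t (d v).+1 v.+1 < cnt t (d v) v then d v else (d v).+1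
    & exists V, forall v, V <= v -> d v = d V].

Section Punctured.

Variables (t : seq (seq nat)) (i j m : nat) (A B : seq nat).
Hypothesis tP : punctured t i j m A B.

Lemma punct_lt_size : i < size t.
Proof.
rewrite ltnNge; apply/negP => le_i; have := punct_row tP.
by rewrite nth_default //; case: (A).
Qed.

Lemma cnt_hole v : m <= v -> cnt t i v = j.+1 + count (fun y => y <= v) B.
Proof.
move=> le_mv; rewrite /cnt (punct_row tP) count_cat /= add1n addnS addSn.
congr (_ + _).+1; rewrite -(punct_col tP); apply/eqP; rewrite -all_count.
have := punct_sorted tP; rewrite sorted_cat_cons => /and4P[_ _ le_A _].
by apply: sub_all le_A => y /leq_trans; apply.
Qed.

Lemma filled_right : filled t i j.+1 = (0 < size B).
Proof.
rewrite /filled /inbox /tget (punct_row tP) size_cat /= (punct_col tP) nth_cat.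
rewrite (punct_col tP) (ltnNge j.+1 j) leqnSn /= subSnn /=.
by case: B (punct_gt0 tP) => [|b B1] /=; [|case/andP]; lia.
Qed.

Lemma tget_right : tget t i j.+1 = nth 0 B 0.
Proof.
rewrite /tget (punct_row tP) nth_cat (punct_col tP).
by rewrite ltnNge leqnSn /= subSnn.
Qed.

Lemma below_leq v : inbox t i.+1 j -> (tget t i.+1 j <= v) = (j < cnt t i.+1 v).
Proof.
by move=> box; rewrite nth_leq_count // (punct_others tP) // gtn_eqF.
Qed.

Lemma filled_below : filled t i.+1 j = (j < size (nth [::] t i.+1)).
Proof.
rewrite /filled; case: (boolP (inbox _ _ _)) => [box|/negPf nbox] /=; last exact: esym nbox.
rewrite -/(inbox t i.+1 j) box lt0n; apply/negP => /eqP e0; have := below_leq m box.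
by rewrite e0 leq0n ltnNge (punct_below tP).
Qed.

Lemma slide_stop : ~~ filled t i.+1 j -> ~~ filled t i j.+1 ->
  slide_result t i m (set_nth [::] t i (take j (nth [::] t i))) (fun=> i).
Proof.
rewrite filled_below filled_right -leqNgt lt0n negbK => no_below /nilP B0.
have sizeE := punct_lt_size; have AE : take j (nth [::] t i) = A.
  by rewrite (punct_row tP) -(punct_col tP) take_size_cat.
have := punct_sorted tP; rewrite sorted_cat_cons => /and4P[srtA _ le_A _].
split=> // [|k v|v le_mv|]; last by exists 0.
- split=> [|k]; first by rewrite size_set_nth; apply/maxn_idPr.
  rewrite nth_set_nth /= AE; have [//|ne_k] := eqVneq k i.
  exact: punct_others tP _ ne_k.
- rewrite /cnt nth_set_nth /= AE; have [->|_] := eqVneq k i; last by rewrite addn0.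
  by rewrite (punct_row tP) count_cat B0 /= addn0.
- rewrite ifT // cnt_hole // ltnS (leq_trans (count_size _ _)) //.
  by rewrite (leq_trans no_below) ?leq_addr.
Qed.

End Punctured.

(** The move permutes row [i], so all [cnt] and hence [d] are unchanged. Between [m] and [e] the
    rule keeps [d] in row [i], because row [i.+1] has at most [j] entries up to [e]. *)
Lemma move_right t i j m A e B : punctured t i j m A (e :: B) ->
  filled t i.+1 j ==> (e < tget t i.+1 j) ->
  let t1 := tset (tset t i j e) i j.+1 0 in
  [/\ punctured t1 i j.+1 e (rcons A e) B, size t1 = size t,
      forall k, size (nth [::] t1 k) = size (nth [::] t k)
    & forall t' d, slide_result t1 i e t' d -> slide_result t i m t' d].
Proof.
move=> tP not_below t1; have lt_i := punct_lt_size tP.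
have size_t1 : size t1 = size t by rewrite !size_tset // size_tset.
have t1i : nth [::] t1 i = rcons A e ++ 0 :: B.
  rewrite !nth_tset !eqxx (punct_row tP) -(punct_col tP) set_nth_cat_cons.
  by rewrite -cat_rcons -(size_rcons A e) set_nth_cat_cons.
have t1k k : k != i -> nth [::] t1 k = nth [::] t k.
  by move=> /negPf ne_k; rewrite !nth_tset ne_k.
have cntE k v : cnt t1 k v = cnt t k v.
  have [->|ne_k] := eqVneq k i; last by rewrite /cnt t1k.
  by rewrite /cnt t1i (punct_row tP) cat_rcons !count_cat /=; lia.
have below : cnt t i.+1 e <= j.
  have := filled_below tP; move: not_below; case: (boolP (filled _ _ _)) => /= [fb lt_e|_ _].
    by have := below_leq tP e; case/andP: fb => -> _ /(_ isT); lia.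
  by move=> /esym/negbT; rewrite -leqNgt; apply: leq_trans; apply: count_size.
have := punct_sorted tP; rewrite sorted_cat_cons => /and4P[srtA srtB le_A /= /andP[le_me ge_B]].
have le_Ae : all (fun y => y <= e) A by apply: sub_all le_A => y /leq_trans; apply.
split=> //.
- split=> //.
  + by rewrite size_rcons (punct_col tP).
  + rewrite sorted_cat_cons -cats1 sorted_cat_cons srtA le_Ae all_cat le_Ae /= leqnn.
    by rewrite (path_sorted srtB) (order_path_min leq_trans srtB).
  + by have /andP[] := punct_gt0 tP.
  + by move=> k ne_k; rewrite t1k // (punct_others tP).
  + by move=> k lt_k v; rewrite !cntE (punct_strip tP).
  + by rewrite cntE leqW.
- move=> k; have [->|ne_k] := eqVneq k i; last by rewrite t1k.
  by rewrite t1i (punct_row tP) !size_cat size_rcons /= !addnS addSn.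
- move=> t' d [[size_t' srt] cnt_t' d_le d_rule d_lim]; split=> //.
  + by rewrite size_t' size_t1.
  + by move=> k v; rewrite cnt_t' cntE.
  + by move=> v le_vm; apply: d_le; apply: leq_trans le_me.
  + move=> v le_mv; case: (leqP e v) => [le_ev|lt_ve]; first by rewrite d_rule // !cntE.
    rewrite (d_le v (ltnW lt_ve)) (d_le v.+1 lt_ve) ifT // (cnt_hole tP) // addSn ltnS.
    by rewrite (leq_trans _ (leq_addr _ _)) // (leq_trans _ below) ?leq_cnt.
Qed.

Lemma move_down t i j m A B : punctured t i j m A B -> filled t i.+1 j ->
  all (leq (tget t i.+1 j)) B ->
  let e := tget t i.+1 j in
  let t1 := tset (tset t i j e) i.+1 j 0 in
  [/\ exists A1 B1, punctured t1 i.+1 j e A1 B1, size t1 = size t,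
      forall k, size (nth [::] t1 k) = size (nth [::] t k)
    & forall t' d', slide_result t1 i.+1 e t' d' -> exists d, slide_result t i m t' d].
Proof.
move=> tP fb le_eB e t1; have /andP[box e_gt0] := fb.
have lt_i1 : i.+1 < size t.
  by rewrite ltnNge; apply/negP => le_i; move: box; rewrite /inbox nth_default.
have size_t1 : size t1 = size t by rewrite size_tset size_tset // ltnW.
have [A1 [B1 [rowE size_A1]]] := split_at box; rewrite -/(tget t i.+1 j) -/e in rowE.
have t1i : nth [::] t1 i = A ++ e :: B.
  rewrite !nth_tset ltn_eqF // eqxx (punct_row tP) -{1}(punct_col tP).
  exact: set_nth_cat_cons.
have t1S : nth [::] t1 i.+1 = A1 ++ 0 :: B1.
  rewrite nth_tset eqxx nth_tset gtn_eqF // rowE -size_A1; exact: set_nth_cat_cons.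
have t1k k : k != i -> k != i.+1 -> nth [::] t1 k = nth [::] t k.
  by move=> /negPf ne_k /negPf ne_k1; rewrite !nth_tset ne_k1 ne_k.
have cntE k v : cnt t1 k v + ((k == i) && (v < e)) = cnt t k v + ((k == i.+1) && (v < e)).
  have [->|ne_k] := eqVneq k i.
    by rewrite /cnt t1i (punct_row tP) !count_cat /= ltn_eqF //; lia.
  have [->|ne_k1] := eqVneq k i.+1; last by rewrite /cnt t1k.
  by rewrite /cnt t1S rowE !count_cat /=; lia.
have belowP v : (e <= v) = (j < cnt t i.+1 v) by apply: below_leq tP _ box.
have lt_me : m < e by rewrite ltnNge belowP -leqNgt (punct_below tP).
have := punct_sorted tP; rewrite sorted_cat_cons => /and4P[srtA srtB le_A ge_B].
have := punct_others tP (k := i.+1); rewrite gtn_eqF // rowE => /(_ isT) srt1.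
split=> //.
- exists A1, B1; split=> //.
  + have := srt1; rewrite sorted_cat_cons => /and4P[_ _ _].
    by apply: sub_all => y; apply: leq_trans.
  + move=> k ne_k1; have [->|ne_k] := eqVneq k i; last by rewrite t1k ?(punct_others tP).
    rewrite t1i sorted_cat_cons srtA srtB le_eB andbT /=.
    by apply: sub_all le_A => y; move: lt_me; clear; lia.
  + move=> k lt_k v; have := cntE k v; have := cntE k.+1 v.+1.
    by have := punct_strip tP (ltnW lt_k) v; lia.
  + have := cntE i.+2 e; have := punct_strip tP (ltnSn i) e.-1.
    by have := belowP e.-1; rewrite prednK //; lia.
- move=> k; have [->|ne_k] := eqVneq k i.
    by rewrite t1i (punct_row tP) !size_cat.
  have [->|ne_k1] := eqVneq k i.+1; last by rewrite t1k.
  by rewrite t1S rowE !size_cat.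
- move=> t' d' [[size_t' srt] cnt_t' d_le d_rule [V d_lim]].
  (* Only the shapes of entries at most [v] with [v < e] see a box move from row [i] to row [i.+1],
     so for them the box is lost in row [i]. *)
  exists (fun v => if v < e then i else d' v); split=> //.
  + by rewrite size_t' size_t1.
  + move=> k v; have := cnt_t' k v; have := cntE k v; have := d_le v.
    by case: (ltnP v e) => [lt_v /(_ (ltnW lt_v)) ->|_ _]; lia.
  + by move=> v le_vm; rewrite (leq_ltn_trans le_vm).
  + move=> v le_mv; case: (ltnP v e) => [lt_ve|le_ev]; last first.
      rewrite ltnNge leqW //= d_rule //.
      by have := cntE (d' v).+1 v.+1; have := cntE (d' v) v; rewrite !ltnNge le_ev (leqW le_ev) !andbF !addn0 => -> ->.
    have := belowP v.+1; rewrite (cnt_hole tP) //.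
    (* The passage to row [i.+1] happens at [v.+1 = e]: then row [i] has exactly [j.+1] entries up
       to [v], as [B] starts at [e] or later, and row [i.+1] has at least as many up to [e]. *)
    move: lt_ve; rewrite leq_eqVlt => /predU1P[eq_v|lt_v1 ? ]; last first.
      by rewrite lt_v1 ifT //; lia.
    rewrite eq_v ltnn leqnn d_le // => /esym lt_c; rewrite ifN // -leqNgt addSn.
    rewrite (_ : count _ B = 0) ?addn0 //; apply/eqP.
    rewrite -leqn0 leqNgt -has_count; apply/hasPn => y /(allP le_eB).
    by rewrite -/e -eq_v; lia.
  + by exists (maxn e V) => v le_v; rewrite !ifN; [rewrite !d_lim| |]; lia.
Qed.

(** With [M] bounding the row lengths, each move lowers the number of rows and columns ahead, so the
    fuel does not run out. *)
Lemma slide_fromP f M t i j m A B : punctured t i j m A B ->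
  (forall k, size (nth [::] t k) <= M) -> (size t - i) + (M - j) <= f ->
  exists d, slide_result t i m (slide_from f t i j) d.
Proof.
elim: f t i j m A B => [|f IHf] t i j m A B tP le_M le_f.
  by have := punct_lt_size tP; lia.
have lt_i := punct_lt_size tP.
have lt_j : j + size B < M.
  by have := le_M i; rewrite (punct_row tP) size_cat /= (punct_col tP) addnS.
have down : filled t i.+1 j -> all (leq (tget t i.+1 j)) B ->
    exists d, slide_result t i m
      (slide_from f (tset (tset t i j (tget t i.+1 j)) i.+1 j 0) i.+1 j) d.
  move=> fb le_B; have [[A1 [B1 tP1]] size_t1 sizes lift] := move_down tP fb le_B.
  have [||d' /lift//] := IHf _ _ _ _ _ _ tP1; last by rewrite size_t1; lia.
  by move=> k; rewrite sizes.
have right b B1 : B = b :: B1 -> filled t i.+1 j ==> (b < tget t i.+1 j) ->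
    exists d, slide_result t i m (slide_from f (tset (tset t i j b) i j.+1 0) i j.+1) d.
  move=> eq_B; rewrite eq_B in tP lt_j => nb.
  have [tP1 size_t1 sizes lift] := move_right tP nb.
  have [||d' /lift] := IHf _ _ _ _ _ _ tP1; last by exists d'.
    by move=> k; rewrite sizes.
  by rewrite size_t1; move: lt_j => /=; lia.
have := filled_right tP; have := tget_right tP; rewrite /=.
case eq_B: B => [|b B1] /= tr fr; rewrite fr tr ?andbF ?andbT.
  case: ifP => fb; first by apply: down; rewrite ?eq_B.
  by exists (fun=> i); apply: (slide_stop tP); rewrite ?fb ?fr.
case: (boolP (filled t i.+1 j)) => fb; last by apply: (right b B1) => //; rewrite (negPf fb).
case: ifP => le_b; last by apply: (right b B1) => //; rewrite fb /= ltnNge le_b.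
apply: down => //; rewrite eq_B /= le_b /=.
have := punct_sorted tP; rewrite sorted_cat_cons eq_B => /and4P[_ /= srt _ _].
have := order_path_min leq_trans srt; apply: sub_all => y; exact: leq_trans.
Qed.

Lemma slide_slid t i j : semistandard t -> cnt t i 0 = j.+1 -> cnt t i.+1 0 <= j ->
  exists d, [/\ slid t (slide t i j) d, semistandard (slide t i j) & d 0 = i].
Proof.
move=> t_sst cnt_i cnt_i1; have [srt strip_t] := t_sst.
have lt_j : j < size (nth [::] t i) by rewrite -cnt_i count_size.
have lt_i : i < size t.
  by rewrite ltnNge; apply/negP => le_i; rewrite nth_default in lt_j.
have t_ij : nth 0 (nth [::] t i) j = 0.
  by apply/eqP; rewrite -leqn0 nth_leq_count // -/(cnt t i 0) cnt_i.
have [A [B [rowE size_A]]] := split_at lt_j; rewrite t_ij in rowE.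
have tE : tset t i j 0 = t.
  apply: (@eq_from_nth _ [::]); rewrite size_tset // => k _; rewrite nth_tset.
  by case: eqP => // ->; rewrite rowE -size_A set_nth_cat_cons.
have tP : punctured t i j 0 A B.
  split=> //; first by rewrite -rowE.
  have := srt i; rewrite rowE sorted_cat_cons => /and4P[_ _ le_A _].
  have := cnt_i; rewrite /cnt rowE count_cat /= (eqP (_ : count _ A == size A)) -?all_count //.
  rewrite size_A => cnt_B; have {}cnt_B : count (leq^~ 0) B = 0 by lia.
  apply/allP => y y_B; rewrite lt0n -leqn0; apply/negP => y0.
  by have : has (leq^~ 0) B; [apply/hasP; exists y | rewrite has_count cnt_B].
rewrite /slide tE; set f := (_ + _).+1.
have [||d [[size_t' srt'] cntE d0 dS d_lim]] := @slide_fromP f (sumn (map size t)) _ _ _ _ _ _ tP.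
- move=> k; have [lt_k|le_k] := ltnP k (size t); last by rewrite nth_default.
  by rewrite sumnE big_map (big_rem _ (mem_nth [::] lt_k)) leq_addr.
- by rewrite /f; lia.
have tt' : slid t (slide_from f t i j) d by split=> // v; apply: dS.
exists d; split=> //; last exact: d0.
exact: slid_semistandard tt' srt'.
Qed.

(** * Skew and standard tableaux *)

Lemma is_partition_part la i : is_partition la -> part la i.+1 <= part la i.
Proof.
case/andP=> _ srt; rewrite /part; have [lt_i|le_i] := ltnP i.+1 (size la).
  by have /sortedP := srt => /(_ 0 i lt_i).
by rewrite nth_default.
Qed.

Lemma skew_sst_semistandard la mu S : is_skew_sst la mu S ->
  semistandard S /\ forall i, cnt S i 0 = part mu i.
Proof.
case=> [[la_part mu_part /andP[le_size /allP le_mu] sizeS] [rowS zeroS rS cS]].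
have srt i : sorted leq (nth [::] S i).
  have [lt_i|le_i] := ltnP i (size S); last by rewrite nth_default.
  rewrite sizeS in lt_i; apply/(sortedP 0) => j lt_j.
  have lt_j' : j.+1 < part la i by rewrite -rowS.
  have := zeroS i j lt_i (ltnW lt_j'); have := zeroS i j.+1 lt_i lt_j'.
  have := rS i j; rewrite /filled /inbox lt_j (ltnW lt_j) /tget /=.
  case: (posnP (nth 0 _ j)) => [-> //|j_gt0]; case: (posnP (nth 0 _ j.+1)) => [->|j1_gt0].
    by move=> _ /esym/ltnW->.
  by move=> ->.
split; last first.
  move=> i; have [lt_i|le_i] := ltnP i (size la); last first.
    by rewrite cnt_default ?sizeS // /part nth_default // (leq_trans le_size).
  have le_mui : part mu i <= part la i by apply: le_mu; rewrite mem_iota.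
  have le_cnt : cnt S i 0 <= part la i by rewrite -rowS ?count_size.
  have eq_lt j : j < part la i -> (j < cnt S i 0) = (j < part mu i).
    by move=> lt_j; rewrite -zeroS // -nth_leq_count ?rowS // leqn0.
  case: (ltngtP (cnt S i 0) (part mu i)) => // lt_c.
    by have := eq_lt _ (leq_trans lt_c le_mui); rewrite ltnn lt_c.
  by have := eq_lt _ (leq_trans lt_c le_cnt); rewrite ltnn lt_c.
(* Column [c] holds the last entry at most [v.+1] of row [i.+1]; it suffices that the box above it,
   empty or filled, is at most [v]. *)
split=> // i v; case cE: (cnt S i.+1 v.+1) => [//|c].
have lt_c : c < size (nth [::] S i.+1) by rewrite -cE count_size.
have lt_i1 : i.+1 < size la.
  by rewrite -sizeS ltnNge; apply/negP => le_i; rewrite nth_default in lt_c.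
have lt_ci : c < size (nth [::] S i).
  by rewrite rowS ?(ltnW lt_i1) // (leq_trans _ (is_partition_part _ la_part)) // -rowS.
have le_c : tget S i.+1 c <= v.+1 by rewrite nth_leq_count // -/(cnt _ _ _) cE.
rewrite -nth_leq_count // -/(tget S i c).
have := zeroS i.+1 c lt_i1; rewrite -rowS // => /(_ lt_c) z1.
have := zeroS i c (ltnW lt_i1); rewrite -rowS ?(ltnW lt_i1) // => /(_ lt_ci) z0.
case: (posnP (tget S i c)) => [-> //|c_gt0]; rewrite -ltnS (leq_trans _ le_c) //.
apply: cS; rewrite /filled /inbox ?lt_ci ?lt_c //= lt0n z1.
apply/negP => lt_mu; move: z0; rewrite gtn_eqF // => /esym/negP; apply.
exact: leq_trans lt_mu (is_partition_part _ mu_part).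
Qed.

Lemma nth_filter_gt0 s i : (forall i, nth 0 s i.+1 <= nth 0 s i) ->
  nth 0 [seq y <- s | 0 < y] i = nth 0 s i.
Proof.
elim: s i => //= y s IHs i mono; have mono_s k := mono k.+1.
case: (posnP y) => [y0|y_gt0]; last by case: i => //= i; rewrite IHs.
have s0 k : nth 0 s k = 0.
  elim: k => [|k IHk]; apply/eqP; rewrite -leqn0.
    by have := mono 0; rewrite /= y0.
  by have := mono_s k; rewrite /= IHk.
by rewrite IHs // s0; case: i => //= i; rewrite s0.
Qed.

Lemma skew_shapeE t : skew_shape t =
  ([seq y <- [seq size r | r <- t] | 0 < y],
   [seq y <- [seq count (fun y => y <= 0) r | r <- t] | 0 < y]).
Proof.
rewrite /skew_shape !filter_map; congr (_, _).
have eq0 r : count (pred1 0) r = count (fun y => y <= 0) r.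
  by apply: eq_count => y; rewrite /= leqn0.
by under eq_filter => r do rewrite eq0; apply: eq_map.
Qed.

Lemma semistandard_size t i : semistandard t ->
  size (nth [::] t i.+1) <= size (nth [::] t i).
Proof.
case=> _ strip_t; have [M cM] := cnt_bounded t.
by rewrite -(cM i M) // -(cM i.+1 M.+1).
Qed.

Lemma eq_skew_shape t1 t2 : size t1 = size t2 ->
  (forall i, size (nth [::] t1 i) = size (nth [::] t2 i)) ->
  (forall i, cnt t1 i 0 = cnt t2 i 0) -> skew_shape t1 = skew_shape t2.
Proof.
move=> eq_size eq_row eq_cnt; rewrite !skew_shapeE; congr (filter _ _, filter _ _);
  apply: (@eq_from_nth _ 0); rewrite ?size_map // => i lt_i;
  by rewrite !(nth_map [::]) -?eq_size //; apply: eq_cnt.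
Qed.

Lemma skew_shape_size t1 t2 : semistandard t1 -> semistandard t2 ->
  skew_shape t1 = skew_shape t2 ->
  forall i, size (nth [::] t1 i) = size (nth [::] t2 i).
Proof.
have sizeE t i : semistandard t ->
    nth 0 [seq y <- [seq size r | r <- t] | 0 < y] i = size (nth [::] t i).
  move=> t_sst; have nthE k : nth 0 [seq size r | r <- t] k = size (nth [::] t k).
    have [lt_k|le_k] := ltnP k (size t); first by rewrite (nth_map [::]).
    by rewrite !nth_default ?size_map.
  by rewrite nth_filter_gt0 => [|k]; rewrite !nthE ?semistandard_size.
move=> sst1 sst2; rewrite !skew_shapeE => -[eq_size _] i.
by rewrite -!sizeE // eq_size.
Qed.

Lemma leq_nth_sumn s i : nth 0 s i <= sumn s.
Proof.
elim: s i => [|y s IHs] [|i] //=; first by rewrite leq_addr.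
by rewrite (leq_trans (IHs i)) ?leq_addl.
Qed.

Lemma leq_nth2_sumn s i k : i != k -> nth 0 s i + nth 0 s k <= sumn s.
Proof.
elim: s i k => [|y s IHs] [|i] [|k] //= ne_ik; last by rewrite (leq_trans (IHs i k ne_ik)) ?leq_addl.
  by rewrite leq_add2l leq_nth_sumn.
by rewrite addnC leq_add2l leq_nth_sumn.
Qed.

Lemma leq_count_step s v :
  count (fun y => y <= v.+1) s = count (fun y => y <= v) s + count_mem v.+1 s.
Proof. by elim: s => //= y s ->; lia. Qed.

(** * Standard tableaux and induction over the slides *)

Section Standard.

Variables (mu : seq nat) (T : seq (seq nat)).
Hypothesis T_std : is_standard mu T.

Lemma standard_mem v i : v \in nth [::] T i -> 0 < v <= sumn mu.
Proof.
have [_ [_ permT _ _]] := T_std; move=> v_i.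
have lt_i : i < size T by rewrite ltnNge; apply/negP => le_i; rewrite nth_default in v_i.
have : v \in flatten T by apply/flattenP; exists (nth [::] T i); rewrite ?mem_nth.
by rewrite (perm_mem permT) mem_iota add1n ltnS.
Qed.

Lemma standard_cnt0 i : cnt T i 0 = 0.
Proof.
apply/eqP; rewrite -leqn0 leqNgt -has_count; apply/hasPn => v /standard_mem.
by rewrite leqn0 lt0n => /andP[].
Qed.

Lemma standard_cnt_sumn i : cnt T i (sumn mu) = part mu i.
Proof.
have [[_ sizeT] [rowT _ _ _]] := T_std.
have -> : cnt T i (sumn mu) = size (nth [::] T i).
  by apply/eqP; rewrite -all_count; apply/allP => v /standard_mem/andP[].
have [lt_i|le_i] := ltnP i (size mu); first exact: rowT.
by rewrite /part !nth_default ?sizeT.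
Qed.

Lemma standard_row i : sorted ltn (nth [::] T i).
Proof.
have [_ [_ _ rT _]] := T_std; apply/(sortedP 0) => j lt_j.
by apply: rT => //; apply: ltnW.
Qed.

Lemma pos_corner k : k < sumn mu ->
  [/\ cnt T (pos T k.+1).1 k.+1 = (pos T k.+1).2.+1,
      cnt T (pos T k.+1).1.+1 k.+1 <= (pos T k.+1).2
    & forall i, cnt T i k + (i == (pos T k.+1).1) = cnt T i k.+1].
Proof.
have [_ [_ permT rT cT]] := T_std => lt_k.
have srt i : sorted leq (nth [::] T i).
  by apply: sub_sorted (standard_row i) => a b /ltnW.
have k_T : has (fun r => k.+1 \in r) T.
  have : k.+1 \in flatten T by rewrite (perm_mem permT) mem_iota; lia.
  by case/flattenP=> r r_T k_r; apply/hasP; exists r.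
rewrite /pos /=; set i := find _ T; set j := index _ _.
have k_i : k.+1 \in nth [::] T i by apply: (nth_find [::] k_T).
have lt_j : j < size (nth [::] T i) by rewrite index_mem.
have ijE : tget T i j = k.+1 by apply: nth_index.
have lt_jc : j < cnt T i k.+1 by rewrite -nth_leq_count // -/(tget T i j) ijE.
split.
- apply/eqP; rewrite eqn_leq lt_jc andbT leqNgt; apply/negP => lt_jc1.
  have lt_j1 : j.+1 < size (nth [::] T i) by apply: leq_trans lt_jc1 (count_size _ _).
  have := rT i j lt_j lt_j1; rewrite ijE ltnNge.
  by rewrite nth_leq_count // lt_jc1.
- rewrite leqNgt; apply/negP => lt_jc1.
  have lt_j1 : j < size (nth [::] T i.+1) by apply: leq_trans lt_jc1 (count_size _ _).
  have := cT i j lt_j lt_j1; rewrite ijE ltnNge.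
  by rewrite nth_leq_count // lt_jc1.
- move=> i'; rewrite /cnt leq_count_step; congr (_ + _).
  have uniqT : uniq (flatten T) by rewrite (perm_uniq permT) iota_uniq.
  have cnt1 : count_mem k.+1 (nth [::] T i) = 1.
    by rewrite count_uniq_mem ?k_i // (sorted_uniq ltn_trans ltnn) ?standard_row.
  have [->|ne_i] := eqVneq i' i; first by rewrite cnt1.
  have nthE l : nth 0 (map (count_mem k.+1) T) l = count_mem k.+1 (nth [::] T l).
    have [lt_l|le_l] := ltnP l (size T); first by rewrite (nth_map [::]).
    by rewrite !nth_default ?size_map.
  (* A second row containing [k.+1] would give it multiplicity at least 2 in [flatten T]. *)
  have := leq_nth2_sumn (map (count_mem k.+1) T) ne_i.
  rewrite !nthE cnt1 -count_flatten (count_uniq_mem _ uniqT).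
  by case: (_ \in _); lia.
Qed.

(** The inner shape is that of the entries of [T] up to [k]. Both slides start at the same corner:
    equal shapes afterwards give equal exit rows, so [cross_inj] lifts equality of arrays back;
    conversely, equal arrays have equal exit rows and equal crossings. *)
Lemma same_changes_circled k t1 t2 : k <= sumn mu ->
  semistandard t1 -> semistandard t2 -> size t1 = size t2 ->
  (forall i, size (nth [::] t1 i) = size (nth [::] t2 i)) ->
  (forall i, cnt t1 i 0 = cnt T i k) -> (forall i, cnt t2 i 0 = cnt T i k) ->
  rect_shapes T k t1 = rect_shapes T k t2 <-> same_circled_array t1 t2.
Proof.
elim: k t1 t2 => [|k IHk] t1 t2 le_k sst1 sst2 eq_size eq_sizes cnt1 cnt2.
  split=> // _; apply/same_circled_arrayE; exists 0 => N _.
  by rewrite !circled_straight // => i; rewrite ?cnt1 ?cnt2 standard_cnt0.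
have [] := pos_corner le_k; rewrite [rect_shapes _ _ t1]/= [rect_shapes _ _ t2]/=.
set i := (pos T k.+1).1; set j := (pos T k.+1).2 => corner below cntS.
have [||d1 [slid1 sst1' d1E]] := slide_slid (i := i) (j := j) sst1; rewrite ?cnt1 //.
have [||d2 [slid2 sst2' d2E]] := slide_slid (i := i) (j := j) sst2; rewrite ?cnt2 //.
set t1' := slide t1 i j in slid1 sst1' *; set t2' := slide t2 i j in slid2 sst2' *.
have [D1 [N1 [size1 exit1]]] := slid_exit sst1 slid1.
have [D2 [N2 [size2 exit2]]] := slid_exit sst2 slid2.
have circ1 := circled_slid sst1 slid1 0; have circ2 := circled_slid sst2 slid2 0.
rewrite d1E in exit1 circ1; rewrite d2E in exit2 circ2.
have cnt1' l : cnt t1' l 0 = cnt T l k.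
  by case: slid1 => _ /(_ l 0) cE _ _; have := cntS l; rewrite -cnt1 -cE d1E; lia.
have cnt2' l : cnt t2' l 0 = cnt T l k.
  by case: slid2 => _ /(_ l 0) cE _ _; have := cntS l; rewrite -cnt2 -cE d2E; lia.
have eq_size' : size t1' = size t2'.
  by case: slid1 slid2 => -> _ _ _ [-> _ _ _].
split.
- move/eqP; rewrite eqseq_cons => /andP[/eqP eq_shape /eqP eq_rect].
  have eq_sizes' := skew_shape_size sst1' sst2' eq_shape.
  have eqD : D1 = D2.
    have := size1 D1; have := size2 D1; rewrite eq_sizes' eq_sizes eqxx.
    by case: eqP => //; lia.
  have [+ _] := IHk _ _ (ltnW le_k) sst1' sst2' eq_size' eq_sizes' cnt1' cnt2'.
  move=> /(_ eq_rect)/same_circled_arrayE[N0 eqN]; apply/same_circled_arrayE.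
  exists (maxn N0 (maxn N1 N2)) => N le_N; have := eqN N; rewrite circ1 circ2.
  have [|ex1 lt1] := exit1 N; first by lia.
  have [|ex2 lt2] := exit2 N; first by lia.
  move=> eq_cross; have [] // := cross_inj _ _ _ _ _ _ (eq_cross _);
    rewrite ?circled_rows ?size_circled ?ex1 ?ex2 //; lia.
- case/same_circled_arrayE=> N0 eqN.
  have eqD : D1 = D2.
    have [|<- _] := exit1 (maxn N0 (maxn N1 N2)); first by lia.
    have [|<- _] := exit2 (maxn N0 (maxn N1 N2)); first by lia.
    by rewrite eqN //; lia.
  have eq_sizes' l : size (nth [::] t1' l) = size (nth [::] t2' l).
    by have := size1 l; have := size2 l; rewrite eq_sizes eqD; lia.
  rewrite (eq_skew_shape eq_size' eq_sizes') => [|l]; last by rewrite cnt1' cnt2'.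
  have [_ ->] := IHk _ _ (ltnW le_k) sst1' sst2' eq_size' eq_sizes' cnt1' cnt2'; first by [].
  by apply/same_circled_arrayE; exists N0 => N le_N; rewrite circ1 circ2 eqN.
Qed.

End Standard.

Lemma same_shape_changesE la mu T S1 S2 :
  is_skew_sst la mu S1 -> is_skew_sst la mu S2 -> is_standard mu T ->
  same_shape_changes T S1 S2 <-> same_circled_array S1 S2.
Proof.
move=> skew1 skew2 T_std; have [sst1 cnt1] := skew_sst_semistandard skew1.
have [sst2 cnt2] := skew_sst_semistandard skew2.
have [[_ _ _ size1] [row1 _ _ _]] := skew1; have [[_ _ _ size2] [row2 _ _ _]] := skew2.
have eq_size : size S1 = size S2 by rewrite size1.
have eq_sizes i : size (nth [::] S1 i) = size (nth [::] S2 i).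
  have [lt_i|le_i] := ltnP i (size la); first by rewrite row1 ?row2.
  by rewrite !nth_default ?size1 ?size2.
have sizeT : size (flatten T) = sumn mu.
  by have [_ [_ /perm_size-> _ _]] := T_std; rewrite size_iota.
rewrite /same_shape_changes /shape_changes sizeT (eq_skew_shape eq_size eq_sizes); last first.
  by move=> i; rewrite cnt1 cnt2.
have [main1 main2] := same_changes_circled T_std (leqnn _) sst1 sst2 eq_size eq_sizes
  (fun i => etrans (cnt1 i) (esym (standard_cnt_sumn T_std i)))
  (fun i => etrans (cnt2 i) (esym (standard_cnt_sumn T_std i))).
by split=> [[/main1] | /main2->].
Qed.

(** * Existence of a standard tableau *)

Fixpoint row_filling (a : nat) (mu : seq nat) : seq (seq nat) :=
  if mu is m :: mu' then iota a m :: row_filling (a + m) mu' else [::].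

Lemma nth_row_filling a mu i :
  nth [::] (row_filling a mu) i = iota (a + sumn (take i mu)) (nth 0 mu i).
Proof.
by elim: mu a i => [|m mu IHmu] a [|i] //=; rewrite ?addn0 // IHmu addnA.
Qed.

Lemma row_filling_standard mu : is_partition mu -> is_standard mu (row_filling 1 mu).
Proof.
move=> mu_part; have getE i j : j < nth 0 mu i ->
    tget (row_filling 1 mu) i j = 1 + sumn (take i mu) + j.
  by move=> lt_j; rewrite /tget nth_row_filling nth_iota.
split; split=> //.
- by elim: (mu) 1 => //= m mu' IHmu a; rewrite IHmu.
- by move=> i _; rewrite nth_row_filling size_iota.
- suff -> : flatten (row_filling 1 mu) = iota 1 (sumn mu) by [].
  by elim: (mu) 1 => //= m mu' IHmu a; rewrite IHmu iotaD.
- move=> i j; rewrite /inbox nth_row_filling size_iota => lt_j lt_j1.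
  by rewrite !getE // addnS.
- move=> i j; rewrite /inbox !nth_row_filling !size_iota => lt_j lt_j1.
  have lt_i : i < size mu by rewrite ltnNge; apply/negP => le_i; rewrite nth_default in lt_j.
  by rewrite !getE // (take_nth 0) // -cats1 sumn_cat /=; lia.
Qed.

Theorem theorem3p12 (la mu : seq nat) (S1 S2 : seq (seq nat)) :
  is_skew_sst la mu S1 -> is_skew_sst la mu S2 ->
  (shape_equivalent mu S1 S2 <->
     exists T, is_standard mu T /\ same_shape_changes T S1 S2) /\
  (shape_equivalent mu S1 S2 <-> same_circled_array S1 S2).
Proof.
move=> skew1 skew2; have changesE := same_shape_changesE skew1 skew2.
have std : is_standard mu (row_filling 1 mu).
  by apply: row_filling_standard; case: skew1 => -[].
(* The array criterion does not depend on [T], so a single standard tableau decides for all of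
   them. *)
have equivE : shape_equivalent mu S1 S2 <-> same_circled_array S1 S2.
  split=> [/(_ _ std)/(changesE _ std)//|circ T T_std].
  exact/(changesE _ T_std).
split=> //; split=> [equiv|[T [T_std /(changesE _ T_std)/equivE//]]].
by exists (row_filling 1 mu); split=> //; apply: equiv.
Qed.
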